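(* The power structure over the ring $K_0^{\rm fGr}({\rm Var}_{\mathbb{C}})$ defined by the Kapranov zeta function $\zeta_{\bullet}(t)$, where for a $G$-variety $(Z,G)$ $$\zeta_{(Z,G)}(t)=1+\sum_{n=1}^\infty[(Z^n,G_n)]\,t^n,$$ is not effective.
   Context: All varieties are complex quasi-projective varieties and all groups denoted $G,H,G_i,\dots$ are finite. $\lambda$-structures and power structures. For a commutative ring $R$ with unity, a $\lambda$-structure is a map $R\to1+tR[[t]]$, $a\mapsto\lambda_a(t)$, with $\lambda_{a+b}(t)=\lambda_a(t)\lambda_b(t)$ and $\lambda_a(t)=1+at+\ldots$. It defines a power structure over $R$, i.e. a map $(1+tR[[t]])\times R\to1+tR[[t]]$, $(A(t),m)\mapsto(A(t))^m$, as follows: each $A(t)\in1+tR[[t]]$ is uniquely a product $\prod_{i=1}^\infty\lambda_{b_i}(t^i)$ with $b_i\in R$, and $(A(t))^m:=\prod_{i=1}^\infty\lambda_{mb_i}(t^i)$. The series $\zeta_{(Z,G)}(t)$ of the claim depends only on the class $[(Z,G)]$ and extends to a $\lambda$-structure on $K_0^{\rm fGr}({\rm Var}_{\mathbb{C}})$. Effectiveness. Let $S_0^{\rm fGr}({\rm Var}_{\mathbb{C}})$ be the Grothendieck semiring defined exactly as $K_0^{\rm fGr}({\rm Var}_{\mathbb{C}})$ (below) with the word ''group'' (for the Abelian group generated by the classes) replaced by ''semigroup''; there is a natural semiring homomorphism $S_0^{\rm fGr}({\rm Var}_{\mathbb{C}})\to K_0^{\rm fGr}({\rm Var}_{\mathbb{C}})$,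 whose image consists of the classes $[\mathcal X]$ of varieties with finite groups actions. A power structure over $K_0^{\rm fGr}({\rm Var}_{\mathbb{C}})$ is effective if, whenever all the coefficients of $A(t)\in1+tK_0^{\rm fGr}({\rm Var}_{\mathbb{C}})[[t]]$ and the exponent $m$ belong to this image, all the coefficients of $(A(t))^m$ belong to it too. Wreath products. For a $G$-variety $Z$, the Cartesian power $Z^n$ carries the natural action of the wreath product $G_n=G^n\rtimes S_n$, generated by the component-wise action of $G^n$ and the action of $S_n$ by permutations of the factors. The ring $K_0^{\rm fGr}({\rm Var}_{\mathbb{C}})$. A variety with a finite groups action is a variety $\mathcal X=\bigsqcup_{i=1}^s(X_i,G_i)$ represented as a finite disjoint union of locally closed subvarieties $X_i$ with left (algebraic) actions of finite groups $G_i$ (different in general). If $s=1$ it is called a variety with a pure action, or a $G$-variety, written $(Z,G)$. A partition of $\mathcal X$ consists of finite partitions of the components $X_i$ into locally closed $G_i$-invariant subvarieties (each piece carrying the group $G_i$). Varieties with pure actions $(Z,G)$, $(Z',G')$ are isomorphic if there are isomorphisms $\varphi:G\to G'$ of groups and $\psi:Z\to Z'$ of varieties with $\psi(gx)=\varphi(g)\psi(x)$. Two varieties with finite groups actions $\mathcal X,\mathcal Y$ are equivalent if they have partitions $\mathcal X=\bigsqcup_{i=1}^N(X_{(i)},G_{(i)})$, $\mathcal Y=\bigsqcup_{i=1}^N(Y_{(i)},G'_{(i)})$ with $(X_{(i)},G_{(i)})$ isomorphic to $(Y_{(i)},G'_{(i)})$ for all $i$. For a $G$-variety $Z$ and a finite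 group $H\supset G$, ${\rm ind}_G^H Z=(H\times Z)/\sim$, where $(h_1,x_1)\sim(h_2,x_2)$ iff there is $g\in G$ with $h_2=h_1g^{-1}$, $x_2=gx_1$; it carries the natural left $H$-action. $K_0^{\rm fGr}({\rm Var}_{\mathbb{C}})$ is the Abelian group generated by the classes $[\mathcal X]$ of varieties with finite groups actions modulo: (1) $[\mathcal X]=[\mathcal Y]$ if $\mathcal X$ and $\mathcal Y$ are equivalent; (2) $[\mathcal X]=[\mathcal Y]+[\mathcal X\setminus\mathcal Y]$ if $\mathcal Y$ is a Zariski closed subvariety of $\mathcal X$ invariant with respect to the groups actions; (3) $[({\rm ind}_G^HZ,H)]=[(Z,G)]$ for a $G$-variety $(Z,G)$ and a finite group $H\supset G$. Multiplication is induced by the Cartesian product: $[(Z_1,G_1)]\cdot[(Z_2,G_2)]=[(Z_1\times Z_2,G_1\times G_2)]$. As an Abelian group it is generated by the classes $[(Z,G)]$ of varieties with pure actions; the unit is the class of the one-point variety with the action of the trivial group. *)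

(* Defs.v *)
From HB Require Import structures.
From mathcomp Require Import all_boot all_order all_algebra all_fingroup.
From mathcomp Require Import boolp classical_sets.
From mathcomp Require Import mpoly.

Set Implicit Arguments.
Unset Strict Implicit.
Unset Printing Implicit Defensive.

Import GRing.Theory.
Local Open Scope classical_set_scope.
Local Open Scope ring_scope.

(** * Quasi-projective varieties over an algebraically closed field *)

Section Varieties.
Variable C : closedFieldType.

(* A point of P^n is represented by the unique vector on the corresponding
   line whose first nonzero homogeneous coordinate is 1. *)
Definition normalized n (v : 'rV[C]_n.+1) : bool :=
  [exists i, (v 0 i == 1) && [forall j : 'I_n.+1, (j < i)%N ==> (v 0 j == 0)]].

Record proj n := Proj { coords :> 'rV[C]_n.+1; _ : normalized coords }.

Definition peval n (p : {mpoly C[n.+1]}) (x : proj n) : C :=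
  p.@[fun i => coords x 0 i].

Definition zariski_closed n (A : set (proj n)) : Prop :=
  exists2 S : set {mpoly C[n.+1]},
    (forall p, S p -> exists d, p \is d.-homog) &
    A = [set x | forall p, S p -> peval p x = 0].

Definition loc_closed n (A : set (proj n)) : Prop :=
  exists B D, [/\ zariski_closed B, zariski_closed D & A = B `\` D].

(* Possibly empty, possibly reducible. *)
Record variety := Variety {
  vdim : nat;
  pts :> proj vdim -> Prop;
  _ : loc_closed pts }.
Arguments pts : clear implicits.

(* A map is regular on A if near each x in A it is given by a tuple F of forms
   of the same degree not all vanishing at x. Multiplying F by a form that is
   nonzero at x, one may assume that F vanishes on A outside of the
   neighbourhood of x under consideration; whence the global form of the
   condition on y, in which c = 0 is allowed. Maps are total on the ambient
   projective spaces: their values outside of A are irrelevant. *)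
Definition regular_on n m (A : set (proj n)) (f : proj n -> proj m) : Prop :=
  forall x, A x -> exists (d : nat) (F : 'I_m.+1 -> {mpoly C[n.+1]}),
    [/\ forall i, F i \is d.-homog,
        exists i, peval (F i) x != 0 &
        forall y, A y -> exists c : C, forall i, peval (F i) y = c * f y 0 i].

Definition vmap (X Y : variety) := proj (vdim X) -> proj (vdim Y).

Definition is_morphism (X Y : variety) (f : vmap X Y) : Prop :=
  (forall x, X x -> Y (f x)) /\ regular_on X f.

Definition is_isomorphism (X Y : variety) (f : vmap X Y) : Prop :=
  is_morphism f /\
  exists g : vmap Y X, [/\ is_morphism g,
    forall x, X x -> g (f x) = x & forall y, Y y -> f (g y) = y].

Definition closed_in (X : variety) (A : set (proj (vdim X))) : Prop :=
  exists2 B, zariski_closed B & A = pts X `&` B.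

(* Isomorphism onto an open subvariety of Y. *)
Definition is_open_immersion (X Y : variety) (f : vmap X Y) : Prop :=
  [/\ is_morphism f,
      exists2 D, zariski_closed D & f @` pts X = Y `\` D &
      exists2 g : vmap Y X, regular_on (f @` pts X) g &
        forall x, X x -> g (f x) = x].

(* Product of a family of varieties, in the category of varieties. *)
Definition is_product (I : Type) (X : I -> variety) (P : variety)
    (pr : forall i, vmap P (X i)) : Prop :=
  (forall i, is_morphism (pr i)) /\
  forall (W : variety) (f : forall i, vmap W (X i)),
    (forall i, is_morphism (f i)) ->
    exists u : vmap W P,
      [/\ is_morphism u,
          forall i w, W w -> pr i (u w) = f i w &
          forall u' : vmap W P, is_morphism u' ->
            (forall i w, W w -> pr i (u' w) = f i w) ->
            forall w, W w -> u' w = u w].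

Definition is_product2 (X Y P : variety) (p1 : vmap P X) (p2 : vmap P Y) :=
  is_product (X := fun b : bool => if b then X else Y)
    (fun b => if b return vmap P (if b then X else Y) then p1 else p2).

(** * Finite group actions *)

Definition is_action (G : finGroupType) (X : variety) (a : G -> vmap X X) :=
  [/\ forall g, is_morphism (a g),
      forall x, X x -> a 1%g x = x &
      forall g h x, X x -> a (g * h)%g x = a g (a h x)].

Record gvar (G : finGroupType) := GVar {
  gv_var :> variety;
  act : G -> vmap gv_var gv_var;
  actP : is_action act }.

Definition giso (G H : finGroupType) (X : gvar G) (Y : gvar H) : Prop :=
  exists (phi : G -> H) (psi : vmap X Y),
    [/\ bijective phi, {morph phi : g h / (g * h)%g}, is_isomorphism psi &
        forall g x, X x -> psi (act g x) = act (phi g) (psi x)].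

Definition inv_subvar (G : finGroupType) (X : gvar G)
    (A : set (proj (vdim X))) : Prop :=
  [/\ loc_closed A, A `<=` pts X & forall g x, A x -> A (act g x)].

Lemma restrict_action (G : finGroupType) (X : gvar G) A
    (hA : inv_subvar (X := X) A) (hl : loc_closed A) :
  is_action (X := Variety hl) (@act G X).
Proof.
case: hA => _ AX Ainv; case: (actP X) => mor a1 aM; split => [g|x|g h x] /=.
- split=> [x|x Ax] /=; first exact: Ainv.
  have [_ reg] := mor g; have [d [F [Fh Fx Fy]]] := reg x (AX _ Ax).
  by exists d, F; split=> // y Ay; apply/Fy/AX.
- by move=> Ax; apply/a1/AX.
- by move=> Ax; apply/aM/AX.
Qed.

Lemma inv_subvar_loc_closed (G : finGroupType) (X : gvar G) A :
  inv_subvar (X := X) A -> loc_closed A.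
Proof. by case. Qed.

Definition grestrict (G : finGroupType) (X : gvar G) (A : set (proj (vdim X)))
    (hA : inv_subvar A) : gvar G :=
  GVar (restrict_action hA (inv_subvar_loc_closed hA)).

(* W, with pi : H x Z -> W, is the H-variety ind_G^H Z, where G is embedded
   into H by j. The variety structure of a quotient of the finite disjoint
   union H x Z by a free action of G that permutes the components h x Z is the
   one for which each component is embedded as an open subvariety. *)
Definition is_induced (G H : finGroupType) (j : G -> H)
    (Z : gvar G) (W : gvar H) : Prop :=
  exists pi : H -> vmap Z W,
    [/\ forall h, is_open_immersion (pi h),
        forall w, W w -> exists h, exists2 x, Z x & w = pi h x,
        forall h1 h2 x1 x2, Z x1 -> Z x2 ->
          (pi h1 x1 = pi h2 x2 <->
           exists g, h2 = (h1 * (j g)^-1)%g /\ x2 = act g x1) &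
        forall h h' x, Z x -> act h' (pi h x) = pi (h' * h)%g x].

Definition is_gproduct (G1 G2 : finGroupType) (Z1 : gvar G1) (Z2 : gvar G2)
    (W : gvar (G1 * G2)%type) : Prop :=
  exists (p1 : vmap W Z1) (p2 : vmap W Z2),
    is_product2 p1 p2 /\
    forall g w, W w ->
      p1 (act g w) = act g.1 (p1 w) /\ p2 (act g w) = act g.2 (p2 w).

End Varieties.

Arguments pts {C} v _.

(** * Wreath products *)

Section Wreath.
Variables (n : nat) (G : finGroupType).

Definition wreath : Type := ({ffun 'I_n -> G} * {perm 'I_n})%type.

HB.instance Definition _ := Finite.on wreath.

(* (a, s) (b, t) = (a . s(b), s o t) with s(b)_i = b_(s^-1 i). The product of
   permutations in the library is composition in the opposite order: s o t is
   (t * s)%g. *)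
Definition wr_mul (u v : wreath) : wreath :=
  ([ffun i => (u.1 i * v.1 ((u.2)^-1%g i))%g], (v.2 * u.2)%g).
Definition wr_one : wreath := ([ffun=> 1%g], 1%g).
Definition wr_inv (u : wreath) : wreath :=
  ([ffun i => ((u.1 (u.2 i))^-1)%g], (u.2^-1)%g).

Lemma wr_mulA : associative wr_mul.
Proof.
move=> u v w; congr pair; last by rewrite /= mulgA.
by apply/ffunP => i; rewrite !ffunE /= invMg permM mulgA.
Qed.

Lemma wr_mul1 : left_id wr_one wr_mul.
Proof.
move=> [a s]; congr pair; last by rewrite /= mulg1.
by apply/ffunP => i; rewrite !ffunE /= invg1 perm1 mul1g.
Qed.

Lemma wr_mulV : left_inverse wr_one wr_inv wr_mul.
Proof.
move=> [a s]; congr pair; last by rewrite /= mulgV.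
by apply/ffunP => i; rewrite !ffunE /= invgK mulVg.
Qed.

HB.instance Definition _ :=
  Finite_isGroup.Build wreath wr_mulA wr_mul1 wr_mulV.

End Wreath.

(* W is the Cartesian power Z^n with its natural action of the wreath product:
   ((a, s) z)_i = a_i z_(s^-1 i). *)
Definition is_wreath_power (C : closedFieldType) (G : finGroupType)
    (Z : gvar C G) (n : nat) (W : gvar C (wreath n G)) : Prop :=
  exists pr : 'I_n -> vmap W Z,
    is_product (X := fun _ : 'I_n => Z : variety C) pr /\
    forall (g : wreath n G) w i, W w ->
      pr i (act g w) = act (g.1 i) (pr ((g.2)^-1%g i) w).

(** * The Grothendieck ring of varieties with finite groups actions *)

Section Grothendieck.
Variable C : closedFieldType.

(* The disjoint union of the (X_i, G_i) for i < fg_num. *)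
Record fgvar := FGVar {
  fg_num : nat;
  fg_group : 'I_fg_num -> finGroupType;
  fg_comp : forall i, gvar C (fg_group i) }.
Arguments fg_comp : clear implicits.

Definition pure (G : finGroupType) (Z : gvar C G) : fgvar :=
  @FGVar 1 (fun=> G) (fun=> Z).

Record partition (X : fgvar) := Partition {
  np : 'I_(fg_num X) -> nat;
  piece : forall i, 'I_(np i) -> set (proj C (vdim (fg_comp X i)));
  pieceP : forall i j, inv_subvar (X := fg_comp X i) (@piece i j);
  piece_cover : forall i x, fg_comp X i x -> exists! j, @piece i j x }.
Arguments pieceP X p i j : clear implicits.

Definition partition_index (X : fgvar) (P : partition X) : Type :=
  {i : 'I_(fg_num X) & 'I_(np P i)}.

Definition fg_equiv (X Y : fgvar) : Prop :=
  exists (P : partition X) (Q : partition Y)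
         (s : partition_index P -> partition_index Q),
    bijective s /\
    forall k, giso (grestrict (pieceP X P _ (projT2 k)))
                   (grestrict (pieceP Y Q _ (projT2 (s k)))).

Definition fg_restrict (X : fgvar)
    (A : forall i, set (proj C (vdim (fg_comp X i))))
    (hA : forall i, inv_subvar (X := fg_comp X i) (A i)) : fgvar :=
  @FGVar (fg_num X) (@fg_group X) (fun i => grestrict (hA i)).

(* In fgrel_closed, hB always follows from hA and the closedness of A: it is
   there because grestrict takes the proof as an argument. *)
Record fg_relations (M : zmodType) (f : fgvar -> M) : Prop := FGRelations {
  fgrel_equiv : forall X Y, fg_equiv X Y -> f X = f Y;
  fgrel_closed : forall (X : fgvar)
    (A : forall i, set (proj C (vdim (fg_comp X i))))
    (hA : forall i, inv_subvar (X := fg_comp X i) (A i))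
    (hB : forall i, inv_subvar (X := fg_comp X i) (pts (fg_comp X i) `\` A i)),
    (forall i, closed_in (X := fg_comp X i) (A i)) ->
    f X = f (fg_restrict hA) + f (fg_restrict hB);
  fgrel_ind : forall (G H : finGroupType) (j : G -> H)
    (Z : gvar C G) (W : gvar C H),
    injective j -> {morph j : g h / (g * h)%g} ->
    is_induced j Z W -> f (pure W) = f (pure Z) }.

(* K, with the class map cl : X |-> [X], is the ring K_0^fGr(Var_C): as an
   Abelian group it is presented by the classes and the relations above. (The
   carrier of a finGroupType being arbitrary, varieties with finite groups
   actions live in too large a universe to index a free zmodType, so that the
   presentation is expressed by its universal property.) The last two fields
   describe the multiplication and the unit. *)
Record is_K0fGr (K : comPzRingType) (cl : fgvar -> K) : Prop := IsK0fGr {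
  K0_rel : fg_relations cl;
  K0_univ : forall (M : zmodType) (f : fgvar -> M), fg_relations f ->
    exists2 h : {additive K -> M}, forall X, h (cl X) = f X &
      forall h' : {additive K -> M}, (forall X, h' (cl X) = f X) -> h' =1 h;
  K0_mul : forall (G1 G2 : finGroupType) (Z1 : gvar C G1) (Z2 : gvar C G2)
    (W : gvar C (G1 * G2)%type), is_gproduct Z1 Z2 W ->
    cl (pure Z1) * cl (pure Z2) = cl (pure W);
  K0_one : forall (G : finGroupType) (X : gvar C G),
    #|{: G}| = 1%N -> (exists x, pts X = [set x]) -> cl (pure X) = 1 }.

End Grothendieck.

Arguments fg_comp {C} f i.
Arguments pieceP {C X} p i j.

(** * lambda-structures and power structures *)

Section PowerStructures.
Variable R : comPzRingType.

(* A : series stands for the formal power series \sum_n (A n) t^n. *)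
Definition series := nat -> R.

Definition series_one : series := fun n => (n == 0%N)%:R.

Definition series_mul (A B : series) : series :=
  fun n => \sum_(i < n.+1) A i * B (n - i)%N.

(* A(t^i), for i > 0 *)
Definition series_subst (A : series) (i : nat) : series :=
  fun n => if (i %| n)%N then A (n %/ i)%N else 0.

Record lambda_structure (lam : R -> series) : Prop := LambdaStructure {
  lam_0 : forall a, lam a 0%N = 1;
  lam_1 : forall a, lam a 1%N = a;
  lam_add : forall a b, lam (a + b) =1 series_mul (lam a) (lam b) }.

(* The infinite product of the lam_(b_i)(t^i) for i >= 1; only the factors
   with i <= n contribute to the coefficient of t^n. *)
Definition lambda_prod (lam : R -> series) (b : nat -> R) : series :=
  fun n => (\big[series_mul/series_one]_(1 <= i < n.+1)
              series_subst (lam (b i)) i) n.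

(* B = A^m in the power structure defined by lam; the sequence b is determined
   by A (up to the irrelevant b_0). *)
Definition is_power (lam : R -> series) (A : series) (m : R) (B : series) :=
  exists2 b : nat -> R, A =1 lambda_prod lam b &
    B =1 lambda_prod lam (fun i => m * b i).

Definition effective_power (lam : R -> series) (eff : R -> Prop) : Prop :=
  forall (A : series) (m : R) (B : series),
    A 0%N = 1 -> (forall n, eff (A n)) -> eff m -> is_power lam A m B ->
    forall n, eff (B n).

End PowerStructures.

(* The image of S_0^fGr(Var_C) in K_0^fGr(Var_C). *)
Definition effective_class (C : closedFieldType) (K : comPzRingType)
    (cl : fgvar C -> K) (x : K) : Prop := exists X : fgvar C, x = cl X.

(* lam is the lambda-structure with lam_[(Z,G)](t) = zeta_(Z,G)(t); it is
   determined by this condition since the classes [(Z,G)] generate K. *)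
Definition kapranov_lambda (C : closedFieldType) (K : comPzRingType)
    (cl : fgvar C -> K) (lam : K -> series K) : Prop :=
  lambda_structure lam /\
  forall (G : finGroupType) (Z : gvar C G) (n : nat) (W : gvar C (wreath n G)),
    (0 < n)%N -> is_wreath_power Z W -> lam (cl (pure Z)) n = cl (pure W).

(* Main.v *)
From HB Require Import structures.
From mathcomp Require Import all_boot all_order all_algebra all_fingroup all_field.
From mathcomp Require Import generic_quotient ring_quotient.
From mathcomp Require Import boolp classical_sets functions mpoly zify lra.
From mathcomp Require Import reals complex.
Require Import Defs.

(* Let G be a group of order 2. The coefficient of t^2 in (1 + t)^[(pt, G)] is
   [(pt, G_2)] - [(pt, G x S_2)]. An additive invariant of varieties with finite
   groups actions that is nonnegative on effective classes and equal to 1 / |G|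
   on (pt, G) shows that it is not effective, since 1/8 - 1/4 < 0.
   Such an invariant is the stacky number of points |X(F_q)| / |G|. To count
   the points of a complex variety over finite fields, its equations are
   specialized: by uniform quantifier elimination for algebraically closed
   fields, a universally quantified formula with constants in C that holds over
   C also holds in the algebraic closure of some F_p after a suitable
   replacement of the constants, hence in a finite subfield that contains them.
   The counts, as functions of the specialization and modulo equality at all
   specializations that satisfy some universal formula true over C, form the
   target group of the invariant; injections of constructible sets given by
   polynomials specialize to injections of finite sets, as in the proof of the
   Ax-Grothendieck theorem. *)

Set Implicit Arguments.
Unset Strict Implicit.
Unset Printing Implicit Defensive.

Import Order.TTheory GRing.Theory Num.Theory.
Local Open Scope classical_set_scope.
Local Open Scope ring_scope.

(** * Elimination of a variable over algebraically closed fields *)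

Section Constructible.
Variable A : idomainType.

Definition dnf := seq (seq A * A).

Definition dnf_holds (F : closedFieldType) (ev : {rmorphism A -> F}) (d : dnf) :=
  has (fun b => all (fun a => ev a == 0) b.1 && (ev b.2 != 0)) d.

(** A single [d] serves all algebraically closed fields and all evaluations at once. This uniformity
    is what later allows the characteristic to change. *)
Definition constructible (P : forall F : closedFieldType, {rmorphism A -> F} -> Prop) :=
  exists d : dnf, forall (F : closedFieldType) (ev : {rmorphism A -> F}), P F ev <->
    dnf_holds ev d.

Lemma constructible_ext P Q :
  (forall (F : closedFieldType) (ev : {rmorphism A -> F}), P F ev <-> Q F ev) ->
  constructible P -> constructible Q.
Proof. by move=> PQ [d dP]; exists d => F ev; rewrite -PQ dP. Qed.

Lemma constructible_false : constructible (fun F ev => False).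
Proof. by exists [::]. Qed.

Lemma constructible_true : constructible (fun F ev => True).
Proof. by exists [:: ([::], 1)] => F ev; rewrite /dnf_holds /= rmorph1 oner_eq0. Qed.

Lemma constructible_eq0 a : constructible (fun F ev => ev a = 0).
Proof.
exists [:: ([:: a], 1)] => F ev.
by rewrite /dnf_holds /= rmorph1 oner_eq0 !andbT orbF; split=> /eqP.
Qed.

Lemma constructible_neq0 a : constructible (fun F ev => ev a <> 0).
Proof. by exists [:: ([::], a)] => F ev; rewrite /dnf_holds /= orbF; split=> /eqP. Qed.

Lemma constructible_or P Q : constructible P -> constructible Q ->
  constructible (fun F ev => P F ev \/ Q F ev).
Proof.
move=> [d dP] [d' dQ]; exists (d ++ d') => F ev.
rewrite dP dQ /dnf_holds has_cat; split=> [[]->|/orP//]; rewrite ?orbT //.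
Qed.

Lemma constructible_and P Q : constructible P -> constructible Q ->
  constructible (fun F ev => P F ev /\ Q F ev).
Proof.
move=> [d dP] [d' dQ].
exists [seq (b.1 ++ b'.1, b.2 * b'.2) | b <- d, b' <- d'] => F ev; rewrite dP dQ.
split=> [[/hasP[b bd /andP[b1 b2]] /hasP[b' bd' /andP[b1' b2']]]|].
  apply/hasP; exists (b.1 ++ b'.1, b.2 * b'.2); last first.
    by rewrite /= all_cat b1 b1' rmorphM mulf_neq0.
  exact: (allpairs_f (fun b b' => (b.1 ++ b'.1, b.2 * b'.2))).
case/hasP=> c /allpairsP[[b b'] /= [bd bd' ->]] /=.
rewrite all_cat rmorphM mulf_eq0 negb_or => /andP[/andP[b1 b1'] /andP[b2 b2']].
by split; apply/hasP; [exists b|exists b'] => //; apply/andP.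
Qed.

Lemma constructible_exists_in (T : eqType) (s : seq T)
    (P : T -> forall F : closedFieldType, {rmorphism A -> F} -> Prop) :
  (forall t, constructible (P t)) ->
  constructible (fun F ev => exists2 t, t \in s & P t F ev).
Proof.
move=> cP; elim: s => [|t s IH].
  by apply: constructible_ext constructible_false => F ev; split=> // -[].
apply: constructible_ext (constructible_or (cP t) IH) => F ev.
split=> [[Pt|[u us Pu]]|[u]].
- by exists t; rewrite ?mem_head.
- by exists u; rewrite ?in_cons ?us ?orbT.
- by rewrite in_cons => /predU1P[->|us] Pu; [left|right; exists u].
Qed.

Lemma constructible_not P : constructible P -> constructible (fun F ev => ~ P F ev).
Proof.
move=> [d dP].
suff: constructible (fun F ev => ~ dnf_holds ev d).
  by apply: constructible_ext => F ev; rewrite dP.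
elim: d {P dP} => [|[s q] d IH].
  by apply: constructible_ext constructible_true => F ev; split.
have cs := constructible_exists_in s constructible_neq0.
apply: constructible_ext
  (constructible_and (constructible_or cs (constructible_eq0 q)) IH) => F ev.
rewrite /dnf_holds /=; set h := has _ d; split.
  case=> H nh; rewrite (negbTE (introN idP nh)) orbF.
  case: H => [[t ts /eqP nt]|->]; last by rewrite eqxx andbF.
  by case/andP=> /allP/(_ _ ts); rewrite (negbTE nt).
move=> /negP; rewrite negb_or => /andP[H /negP nh]; split=> //.
case/nandP: H; last by move/negPn/eqP; right.
by case/allPn=> t ts /eqP nt; left; exists t.
Qed.

Definition has_solution (ps : seq {poly A}) (q : {poly A})
    (F : closedFieldType) (ev : {rmorphism A -> F}) :=
  exists2 x, forall p, p \in ps -> root (map_poly ev p) x & ~~ root (map_poly ev q) x.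

Lemma constructible_neq0_poly (q : {poly A}) :
  constructible (fun F ev => map_poly ev q <> 0).
Proof.
have := constructible_exists_in (iota 0 (size q)) (fun i => constructible_neq0 q`_i).
apply: constructible_ext => F ev; split=> [[i _ nz] q0|nz].
  by apply: nz; rewrite -coef_map q0 coef0.
have nz' : lead_coef (map_poly ev q) != 0 by rewrite lead_coef_eq0; apply/eqP.
exists (size (map_poly ev q)).-1; last first.
  by apply/eqP; rewrite -coef_map.
have sz0 : (0 < size (map_poly ev q))%N by rewrite size_poly_gt0; apply/eqP.
by rewrite mem_iota /= add0n prednK // size_poly.
Qed.

(** The polynomial [q * 'X + 1] is not a nonzero constant, hence has a root, and at a root of [q] it
    takes the value 1. *)
Lemma nonroot_exists (F : closedFieldType) (q : {poly F}) :
  q != 0 -> exists x, ~~ root q x.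
Proof.
move=> nz; have /closed_rootP[x] : size (q * 'X + 1) != 1%N.
  by rewrite size_MXaddC (negbTE nz) /= eqSS size_poly_eq0.
rewrite /root !hornerE => /eqP h; exists x; apply/eqP=> qx.
by move: h; rewrite qx mul0r add0r; move/eqP; rewrite oner_eq0.
Qed.

(** Since [p] splits into linear factors, if all its roots are roots of [q], then each factor
    divides [q], and as many factors [q] as the degree of [p] absorb [p]. This turns the existence
    of a point into a divisibility. *)
Lemma nonroot_dvdp (F : closedFieldType) (p q : {poly F}) : p != 0 ->
  (exists2 x, root p x & ~~ root q x) <-> ~~ (p %| q ^+ size p).
Proof.
move=> p0; split=> [[x px qx]|].
  apply/negP=> /root_dvdp/(_ px); rewrite /root horner_exp.
  by rewrite expf_eq0 (negbTE (_ : q.[x] != 0)) ?andbF.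
move=> ndvd; apply: contrapT => nx; case/negP: ndvd.
have rootq x : root p x -> root q x.
  by move=> px; apply/negPn/negP=> qx; apply: nx; exists x.
have [r pE] := closed_field_poly_normal p; move: p0 rootq; rewrite pE.
set c := lead_coef p; rewrite scaler_eq0 negb_or => /andP[c0 _] rootq.
rewrite dvdpZl // size_scale // size_prod_XsubC exprS dvdp_mull //.
have {}rootq x : x \in r -> root q x.
  by move=> xr; apply: rootq; rewrite rootZ // root_prod_XsubC.
elim: r rootq {pE} => [|y r IH] rootq; first by rewrite big_nil dvd1p.
rewrite big_cons exprS dvdp_mul //.
  by rewrite dvdp_XsubCl rootq ?mem_head.
by apply: IH => x xr; rewrite rootq // in_cons xr orbT.
Qed.

(** Pseudo-division multiplies [p2] by a power of the leading coefficient of [p1]; where this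
    coefficient does not vanish, [p2] and the remainder have the same zeros among the roots of
    [p1]. *)
Lemma has_solution_cons_modp (p1 p2 : {poly A}) ps q (F : closedFieldType)
    (ev : {rmorphism A -> F}) : ev (lead_coef p1) <> 0 ->
  has_solution (p1 :: p2 :: ps) q ev <-> has_solution (p1 :: p2 %% p1 :: ps) q ev.
Proof.
move=> /eqP nz.
have E := congr1 (map_poly ev) (Pdiv.Idomain.divp_eq p2 p1).
rewrite rmorphD rmorphM /= map_polyZ rmorphXn /= in E.
have rE x : root (map_poly ev p1) x ->
    root (map_poly ev (p2 %% p1)) x = root (map_poly ev p2) x.
  move=> /rootP r1; have := congr1 (horner^~ x) E.
  rewrite !hornerE r1 mulr0 add0r /root => <-.
  by rewrite mulf_eq0 expf_eq0 (negbTE nz) andbF.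
split=> -[x sol qx]; exists x => // p; have r1 := sol p1 (mem_head _ _);
  rewrite !in_cons => /or3P[/eqP->//|/eqP->|pps].
- by rewrite rE // sol // !in_cons eqxx orbT.
- by rewrite sol // !in_cons pps !orbT.
- by rewrite -rE // sol // !in_cons eqxx orbT.
- by rewrite sol // !in_cons pps !orbT.
Qed.

Lemma map_poly_behead (p : {poly A}) (F : closedFieldType) (ev : {rmorphism A -> F}) :
  ev (lead_coef p) = 0 ->
  map_poly ev (p - lead_coef p *: 'X^((size p).-1)) = map_poly ev p.
Proof. by move=> e; rewrite rmorphB /= map_polyZ /= e scale0r subr0. Qed.

Lemma size_behead_lt (p : {poly A}) : p != 0 ->
  (size (p - lead_coef p *: 'X^((size p).-1))%R < size p)%N.
Proof.
move=> p0; have sp : (0 < size p)%N by rewrite size_poly_gt0.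
rewrite -[X in (_ < X)%N](prednK sp) ltnS; apply/leq_sizeP => j le_j.
rewrite coefB coefZ coefXn; move: le_j; rewrite leq_eqVlt => /predU1P[<-|lt_j].
  by rewrite eqxx mulr1 lead_coefE subrr.
rewrite (gtn_eqF lt_j) mulr0 subr0 nth_default //.
by rewrite -(prednK sp).
Qed.

Lemma has_solution_perm ps ps' q (F : closedFieldType) (ev : {rmorphism A -> F}) :
  ps =i ps' -> has_solution ps q ev <-> has_solution ps' q ev.
Proof.
by move=> E; split=> -[x sol qx]; exists x => // p; [rewrite -E|rewrite E]; apply: sol.
Qed.

(** As the leading coefficient survives, [p] keeps its degree under [ev], and the divisibility
    criterion of [nonroot_dvdp] amounts to the vanishing of a pseudo-remainder computed over [A]. *)
Lemma has_solution1 (p q : {poly A}) (F : closedFieldType) (ev : {rmorphism A -> F}) :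
  ev (lead_coef p) <> 0 ->
  has_solution [:: p] q ev <-> map_poly ev ((q ^+ size p) %% p) <> 0.
Proof.
move=> /eqP nz.
have szp : size (map_poly ev p) = size p by rewrite size_map_poly_id0.
have p0 : map_poly ev p != 0.
  by rewrite -lead_coef_eq0 lead_coef_map_id0 ?rmorph0.
have -> : has_solution [:: p] q ev <->
    exists2 x, root (map_poly ev p) x & ~~ root (map_poly ev q) x.
  split=> -[x sol qx]; exists x => //; first exact/sol/mem_head.
  by move=> p'; rewrite inE => /eqP->.
rewrite nonroot_dvdp // szp.
have E := congr1 (map_poly ev) (Pdiv.Idomain.divp_eq (q ^+ size p) p).
rewrite rmorphD rmorphM /= map_polyZ !rmorphXn /= in E.
have <- : (map_poly ev p %| ev (lead_coef p) ^+ scalp (q ^+ size p) p *: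
  map_poly ev q ^+ size p)
   = (map_poly ev p %| map_poly ev q ^+ size p).
  by rewrite dvdpZr // expf_neq0.
rewrite E dvdp_addr ?dvdp_mull //.
split=> [ndvd e|nz']; first by rewrite e dvdp0 in ndvd.
apply/negP=> /dvdp_leq; rewrite szp => h; have /h : map_poly ev (q ^+ size p %% p) !=
  0 by apply/eqP.
rewrite leqNgt => /negP; apply; apply: leq_ltn_trans (size_poly _ _) _.
by rewrite ltn_modp -lead_coef_eq0; apply: contra nz => /eqP ->; rewrite rmorph0.
Qed.

(** Euclid's algorithm on the equations, with a case distinction on the vanishing of leading
    coefficients, until at most one equation is left. The successor in the measure makes the
    deletion of a zero polynomial count as progress. *)
Lemma constructible_has_solution ps (q : {poly A}) : constructible (has_solution ps q).
Proof.
have [m] := ubnP (\sum_(p <- ps) (size p).+1).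
elim: m => // m IHm in ps *; rewrite ltnS => le_m.
case: ps le_m => [|p1 ps] le_m.
  apply: constructible_ext (constructible_neq0_poly q) => F ev.
  split=> [/eqP/nonroot_exists[x]|[x _ qx] q0]; first by exists x.
  by rewrite q0 root0 in qx.
have [p10|p1N0] := eqVneq p1 0.
  have : constructible (has_solution ps q).
    by apply: IHm; apply: leq_trans le_m; rewrite big_cons addSn ltnS leq_addl.
  apply: constructible_ext => F ev; split=> -[x sol qx]; exists x => // p.
    rewrite in_cons => /predU1P[->|/sol//]; by rewrite p10 rmorph0 root0.
  by move=> pps; apply: sol; rewrite in_cons pps orbT.
have low (p : {poly A}) s : p != 0 -> (\sum_(p <- p :: s) (size p).+1 <= m)%N ->
   constructible (fun F ev => ev (lead_coef p) = 0 /\ has_solution (p :: s) q ev).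
  move=> pN0 les.
  apply: constructible_ext (constructible_and (constructible_eq0 (lead_coef p))
    (IHm (p - lead_coef p *: 'X^((size p).-1) :: s) _)) => [F ev|].
    split=> -[e [x sol qx]]; split=> //; exists x => // p';
      rewrite in_cons => /predU1P[->|p's].
    - by rewrite -map_poly_behead // sol ?mem_head.
    - by rewrite sol // in_cons p's orbT.
    - by rewrite map_poly_behead // sol ?mem_head.
    - by rewrite sol // in_cons p's orbT.
  by apply: leq_trans les; rewrite !big_cons addSn ltnS ltn_add2r size_behead_lt.
have split0 (p : {poly A}) s : p != 0 -> (\sum_(p <- p :: s) (size p).+1 <= m)%N ->
   constructible (fun F ev => ev (lead_coef p) <> 0 /\ has_solution (p :: s) q ev) ->
   constructible (has_solution (p :: s) q).
  move=> pN0 les ch; apply: constructible_ext (constructible_or (low p s pN0 les) ch) =>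
    F ev.
  split=> [[[]|[]]//|h]; by have [e|e] := pselect (ev (lead_coef p) = 0); [left|right].
case: ps le_m => [|p2 ps] le_m.
  apply: split0 => //; apply: constructible_ext
    (constructible_and (constructible_neq0 (lead_coef p1))
       (constructible_neq0_poly (q ^+ size p1 %% p1))) => F ev.
  by split=> -[e h]; split=> //; apply/has_solution1.
(* Where the leading coefficient of [u] does not vanish, [v] is replaced by its remainder, which is
   shorter. *)
have red (u v : {poly A}) : u != 0 -> (size u <= size v)%N ->
    (\sum_(p <- u :: v :: ps) (size p).+1 <= m)%N ->
    constructible (has_solution (u :: v :: ps) q).
  move=> u0 le_uv les; apply: split0 => //.
  apply: constructible_ext (constructible_and (constructible_neq0 (lead_coef u))
    (IHm (u :: v %% u :: ps) _)) => [F ev|].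
    split=> -[e h]; split=> //.
      by apply/(has_solution_cons_modp v ps q e).
    by apply/(has_solution_cons_modp v ps q e).
  apply: leq_trans les; rewrite !big_cons ltn_add2l ltn_add2r ltnS.
  by apply: leq_trans le_uv; rewrite ltn_modp.
have [le12|/ltnW le21] := leqP (size p1) (size p2); first exact: red.
have sw : constructible (has_solution (p2 :: p1 :: ps) q).
  have [p20|p20] := eqVneq p2 0; last by apply: red => //; move: le_m;
    rewrite !big_cons addnCA.
  have : constructible (has_solution (p1 :: ps) q).
    by apply: IHm; apply: leq_trans le_m; rewrite !big_cons ltn_add2l addSn ltnS leq_addl.
  apply: constructible_ext => F ev; split=> -[x sol qx]; exists x => // p.
    rewrite in_cons => /predU1P[->|/sol//]; by rewrite p20 rmorph0 root0.
  by move=> pps; apply: sol; rewrite in_cons pps orbT.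
apply: constructible_ext sw => F ev; apply: has_solution_perm => p.
by rewrite !in_cons orbCA.
Qed.

Theorem constructible_exists (d : seq (seq {poly A} * {poly A})) :
  constructible (fun F ev => exists x, has (fun b =>
    all (fun p => root (map_poly ev p) x) b.1 && ~~ root (map_poly ev b.2) x) d).
Proof.
have := constructible_exists_in d (fun b => constructible_has_solution b.1 b.2).
apply: constructible_ext => F ev; split=>
  [[b bd [x sol qx]]|[x /hasP[b bd /andP[/allP sol qx]]]].
  by exists x; apply/hasP; exists b => //; rewrite qx andbT; apply/allP.
by exists b => //; exists x.
Qed.

End Constructible.

(** * Transfer from characteristic 0 to positive characteristic *)

(** Polynomials in [k] variables as iterated univariate ones. The last variable is the outermost, so
    that [constructible_exists] eliminates it and leaves a condition on the others. *)
Fixpoint ipoly (R : idomainType) (k : nat) : idomainType :=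
  if k is k'.+1 then {poly ipoly R k'} else R.

Fixpoint ieval (R : idomainType) (F : comNzRingType) (f : {rmorphism R -> F})
    (e : nat -> F) (k : nat) : {rmorphism ipoly R k -> F} :=
  match k return {rmorphism ipoly R k -> F} with
  | 0 => f
  | k'.+1 => horner_eval (e k') \o map_poly (ieval f e k')
  end.

Fixpoint iconst (R : idomainType) (k : nat) (c : R) : ipoly R k :=
  match k return ipoly R k with
  | 0 => c
  | k'.+1 => (iconst k' c)%:P
  end.

Fixpoint ivar (R : idomainType) (k i : nat) : ipoly R k :=
  match k return ipoly R k with
  | 0 => 0
  | k'.+1 => if i == k' then 'X else (ivar R k' i)%:P
  end.

Lemma ieval_const (R : idomainType) (F : comNzRingType) (f : {rmorphism R -> F}) e k c :
  ieval f e k (iconst k c) = f c.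
Proof. by elim: k => //= k IH; rewrite map_polyC /horner_eval hornerC /= IH. Qed.

Lemma ieval_var (R : idomainType) (F : comNzRingType) (f : {rmorphism R -> F}) e k i :
  (i < k)%N -> ieval f e k (ivar R k i) = e i.
Proof.
elim: k => // k IH; rewrite ltnS leq_eqVlt /= => /predU1P[->|lt_ik].
  by rewrite eqxx map_polyX /horner_eval hornerX.
by rewrite (ltn_eqF lt_ik) map_polyC /horner_eval hornerC /= IH.
Qed.

Local Notation Zpoly := (ipoly int).
Local Notation Zeval := (ieval (intmul 1)).
Local Notation Zvar := (ivar int).

Definition upd (T : Type) (e : nat -> T) (k : nat) (x : T) : nat -> T :=
  fun i => if i == k then x else e i.

Lemma eq_Zeval (F : closedFieldType) (e e' : nat -> F) k :
  (forall i, (i < k)%N -> e i = e' i) -> Zeval e k =1 Zeval e' k.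
Proof.
elim: k => // k IH ee' p /=.
rewrite /horner_eval (eq_map_poly (IH _)) ?ee' // => i lt_ik.
by rewrite ee' // ltnW.
Qed.

Lemma Zeval_upd (F : closedFieldType) (e : nat -> F) k x (p : Zpoly k.+1) :
  Zeval (upd e k x) k.+1 p = (map_poly (Zeval e k) p).[x].
Proof.
rewrite /= /horner_eval /upd eqxx; congr _.[x]; apply: eq_map_poly; apply: eq_Zeval => i.
by move/ltn_eqF ->.
Qed.

(** The coefficients are integers, hence meaningful in every characteristic; constants of a
    particular field enter as values of variables. *)
Definition Zconstructible k (P : forall F : closedFieldType, (nat -> F) -> Prop) :=
  exists d : dnf (Zpoly k), forall (F : closedFieldType) (e : nat -> F),
    P F e <-> dnf_holds (Zeval e k) d.

Lemma Zconstructible_exists k P :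
  Zconstructible k.+1 P -> Zconstructible k (fun F e => exists x, P F (upd e k x)).
Proof.
move=> [d dP]; have [d' dP'] := constructible_exists d; exists d' => F e.
have E x : dnf_holds (Zeval (upd e k x) k.+1) d = has (fun b =>
    all (fun p => root (map_poly (Zeval e k) p) x) b.1 &&
    ~~ root (map_poly (Zeval e k) b.2) x) d.
  apply: eq_has => -[s q]; rewrite /fst /snd /root -Zeval_upd; congr andb.
  by apply: eq_all => p; rewrite Zeval_upd.
by rewrite -dP'; split=> -[x hx]; exists x; move: hx; rewrite dP E.
Qed.

Lemma Zconstructible_not k P :
  Zconstructible k P -> Zconstructible k (fun F e => ~ P F e).
Proof.
move=> [d dP]; have [|d' dP'] := @constructible_not _ (fun F ev => dnf_holds ev d).
  by exists d.
by exists d' => F e; rewrite dP dP'.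
Qed.

Lemma Zconstructible_ext k (P Q : forall F : closedFieldType, (nat -> F) -> Prop) :
  (forall (F : closedFieldType) (e : nat -> F), P F e <-> Q F e) ->
  Zconstructible k P -> Zconstructible k Q.
Proof. by move=> PQ [d dP]; exists d => F e; rewrite -PQ dP. Qed.

Definition overwrite (T : Type) (e x : nat -> T) k l : nat -> T :=
  fun i => if (k <= i < k + l)%N then x i else e i.

Lemma Zconstructible_existsn k l P :
  Zconstructible (k + l) P ->
  (forall (F : closedFieldType) (e e' : nat -> F),
    (forall i, (i < k + l)%N -> e i = e' i) -> P F e -> P F e') ->
  Zconstructible k (fun F e => exists x, P F (overwrite e x k l)).
Proof.
elim: l P => [|l IH] P cP extP.
  rewrite addn0 in cP extP; apply: Zconstructible_ext cP => F e; split.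
    by move=> Pe; exists e; apply: extP Pe => i _; rewrite /overwrite if_same.
  by case=> x; apply: extP => i; rewrite /overwrite addn0 ltnNge => /negbTE->.
rewrite addnS in cP extP.
have /IH := Zconstructible_exists cP.
case=> [F e e' ee' [x Px]|d dP].
  exists x; apply: extP Px => i; rewrite ltnS leq_eqVlt /upd.
  by case: eqVneq => //= _ /ee'.
exists d => F e; rewrite -dP; split=> [[x Px]|[x [y Px]]].
  exists x, (x (k + l)%N); apply: extP Px => i.
  rewrite ltnS leq_eqVlt /upd /overwrite addnS ltnS.
  have [->|ne] /= := eqVneq; first by rewrite leq_addr leqnn.
  by rewrite [(i <= _)%N]leq_eqVlt (negbTE ne).
exists (upd x (k + l)%N y); apply: extP Px => i.
rewrite ltnS leq_eqVlt /upd /overwrite addnS ltnS.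
have [->|ne] /= := eqVneq; first by rewrite leq_addr leqnn.
by rewrite [(i <= _)%N]leq_eqVlt (negbTE ne).
Qed.

(** * Transfer of sentences to algebraic closures of prime fields *)

Definition Fp_closure (p : nat) : countClosedFieldType :=
  projT1 (countable_algebraic_closure 'F_p).

Definition Fp_embedding (p : nat) : {rmorphism 'F_p -> Fp_closure p} :=
  sval (projT2 (countable_algebraic_closure 'F_p)).

Lemma Fp_closure_integral p : integralRange (Fp_embedding p).
Proof. exact: svalP (projT2 (countable_algebraic_closure 'F_p)). Qed.

Lemma Fp_closure_pchar p : prime p -> p \in [pchar Fp_closure p].
Proof. by move=> pr; rewrite (rmorph_pchar (Fp_embedding p)) // pchar_Fp. Qed.

(** Without variables, [d] consists of finitely many integers. Modulo a prime that exceeds all their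
    absolute values, the same ones vanish as in characteristic 0. *)
Lemma Zconstructible0_transfer (P : forall F : closedFieldType, (nat -> F) -> Prop)
    (C : closedFieldType) (e : nat -> C) :
  [pchar C] =i pred0 -> Zconstructible 0 P -> P C e ->
  exists2 p, prime p & forall e : nat -> Fp_closure p, P _ e.
Proof.
move=> C0 [d dP]; rewrite dP => h.
pose N := (\max_(z <- flatten [seq b.2 :: b.1 | b <- d]) `|z|)%N.
have [p ltNp pr] := prime_above N; exists p => // e'; rewrite dP; move: h.
suff zE z : z \in flatten [seq b.2 :: b.1 | b <- d] ->
    (Zeval e 0 z == 0) = (Zeval e' 0 z == 0).
  rewrite /dnf_holds => /hasP[b bd /andP[/allP b1 b2]]; apply/hasP; exists b => //.
  have bm : forall a, a \in b.2 :: b.1 -> (Zeval e 0 a == 0) = (Zeval e' 0 a == 0).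
    by move=> a ab; apply: zE; apply/flatten_mapP; exists b.
  rewrite -bm ?mem_head // b2 andbT; apply/allP => a ab.
  by rewrite -bm ?b1 // in_cons ab orbT.
move=> zd; have lez : (`|z|%N <= N)%N by apply: (leq_bigmax_seq z).
have pz : (`|z|%N%:R == 0 :> Fp_closure p) = (`|z|%N == 0%N).
  rewrite -(dvdn_pcharf (Fp_closure_pchar pr)); have [->|z0] := eqVneq `|z|%N 0%N;
    first by rewrite dvdn0.
  by rewrite gtnNdvd ?lt0n ?(leq_ltn_trans lez ltNp).
have Cz := (pcharf0P _).1 C0 `|z|%N.
by case: z {zd lez} pz Cz => n /= pz Cz; rewrite ?NegzE ?rmorphN ?oppr_eq0 /=
  -?pmulrn ?pz ?Cz.
Qed.

(** Both blocks of quantifiers, first the universal one over [x] by double negation and then the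
    existential one over [c], are eliminated; what remains is a condition on integers. *)
Lemma lefschetz k l (P : forall F : closedFieldType, (nat -> F) -> Prop)
  (C : closedFieldType) :
  [pchar C] =i pred0 -> Zconstructible (k + l) P ->
  (forall (F : closedFieldType) (e e' : nat -> F),
     (forall i, (i < k + l)%N -> e i = e' i) -> P F e -> P F e') ->
  (exists c, forall x, P C (overwrite c x k l)) ->
  exists2 p, prime p & exists c : nat -> Fp_closure p, forall x, P _ (overwrite c x k l).
Proof.
move=> C0 cP extP [c Pc].
have cnP := Zconstructible_existsn (Zconstructible_not cP)
  (fun F e e' ee' nP Pe' => nP (extP F e' e (fun i lt_i => esym (ee' i lt_i)) Pe')).
have cP2 := @Zconstructible_existsn 0 k _ (Zconstructible_not cnP).
have [||p pr h] := Zconstructible0_transfer (e := fun=> 0) C0 (cP2 _) _.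
- move=> F e e' ee' ne [x nP]; apply: ne; exists x => Pe; apply: nP; apply: extP Pe.
  by move=> i lt_i; rewrite /overwrite; case: ifP => // /negbT;
    rewrite lt_i andbT -ltnNge => /ee'.
- exists c => -[x]; apply; apply: extP (Pc x) => i lt_i.
  by rewrite /overwrite lt_i andbT; case: leqP.
exists p => //; have [c' nP] := h (fun=> 0); exists c' => x; apply: contrapT => nPx.
apply: nP; exists x => Px; apply: nPx; apply: extP Px => i lt_i.
by rewrite /overwrite lt_i andbT; case: leqP.
Qed.

(** * Finite subfields of the algebraic closure of a prime field *)

Lemma Fp_closure_periodic p (a : Fp_closure p) : prime p ->
  exists2 k, (0 < k)%N & a ^+ (p ^ k) = a.
Proof.
move=> pr; have pc := Fp_closure_pchar pr.
have [P Pmon Pa] := Fp_closure_integral a.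
have P0 := monic_neq0 Pmon.
have aE n : a ^+ n = (map_poly (Fp_embedding p) ('X^n %% P)).[a].
  have := congr1 (fun q => (map_poly (Fp_embedding p) q).[a]) (Pdiv.Field.divp_eq 'X^n P).
  by rewrite rmorphD rmorphM /= map_polyXn !hornerE (rootP Pa) mulr0 add0r.
(* Pigeonhole: the iterated Frobenius images of [a] are values at [a] of remainders modulo [P], of
   which there are finitely many. Two images coincide, and the injectivity of Frobenius cancels the
   smaller exponent. *)
pose d := size P; pose N := #|{: 'rV['F_p]_d}|.
pose f (i : 'I_N.+1) : 'rV['F_p]_d := poly_rV ('X^(p ^ i) %% P).
have : ~~ injectiveb f.
  by apply/injectiveP => /leq_card; rewrite card_ord ltnn.
case/injectivePn => i [j ij fij].
wlog lt_ij : i j ij fij / (i < j)%N.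
  move=> h; case: (ltngtP i j) => [|lt_ji|/val_inj eq_ij]; first exact: h ij fij.
    by apply: h (esym fij) lt_ji; rewrite eq_sym.
  by rewrite eq_ij eqxx in ij.
have E : a ^+ (p ^ i) = a ^+ (p ^ j).
  have sz n : (size ('X^n %% P)%R <= d)%N by rewrite ltnW // ltn_modp.
  by have /(congr1 rVpoly) := fij; rewrite !aE !poly_rV_K // => ->.
exists (j - i)%N; first by rewrite subn_gt0.
have nat_pi : ([pchar Fp_closure p]).-nat (p ^ i)%N by rewrite pnatX (pnatE _ pr) pc.
have : (a ^+ (p ^ (j - i)) - a) ^+ (p ^ i) = 0.
  apply: (addIr (a ^+ (p ^ i))); rewrite add0r -exprDn_pchar // subrK -exprM -expnD.
  by rewrite subnK ?(ltnW lt_ij).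
by move/eqP; rewrite expf_eq0 subr_eq0 => /andP[_ /eqP].
Qed.

Record subfield_seq (F : fieldType) (s : seq F) : Prop := SubfieldSeq {
  subfield_seq0 : 0 \in s;
  subfield_seq1 : 1 \in s;
  subfield_seqD : forall x y, x \in s -> y \in s -> x + y \in s;
  subfield_seqM : forall x y, x \in s -> y \in s -> x * y \in s;
  subfield_seqV : forall x, x \in s -> x^-1 \in s }.

(** The finite subfield is the fixed field of a power of Frobenius, that is, the set of roots of
    ['X^(p ^ N) - 'X], where [N] is a common multiple of the periods of the elements of [cs]. *)
Lemma Fp_closure_subfield p (cs : seq (Fp_closure p)) : prime p ->
  exists2 s : seq (Fp_closure p), subfield_seq s & {subset cs <= s}.
Proof.
move=> pr; have pc := Fp_closure_pchar pr.
have [N N0 Ncs] : exists2 N, (0 < N)%N & forall a, a \in cs -> a ^+ (p ^ N) = a.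
  elim: cs => [|a cs [N N0 IH]]; first by exists 1%N.
  have [k k0 ak] := Fp_closure_periodic a pr.
  have iterE x m n : x ^+ (p ^ m) = x -> x ^+ (p ^ (m * n)) = x :> Fp_closure p.
    by move=> xm; elim: n => [|n IHn]; rewrite ?muln0 ?expr1 // mulnS expnD exprM xm.
  exists (k * N)%N => [|b]; first by rewrite muln_gt0 k0.
  by rewrite in_cons => /predU1P[->|/IH bN]; [|rewrite mulnC]; apply: iterE.
have natq : ([pchar Fp_closure p]).-nat (p ^ N)%N by rewrite pnatX (pnatE _ pr) pc.
have q1 : (1 < p ^ N)%N by rewrite -(exp1n N) ltn_exp2r // prime_gt1.
pose P : {poly Fp_closure p} := 'X^(p ^ N) - 'X.
have [s sE] := closed_field_poly_normal P.
have P0 : P != 0.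
  rewrite -size_poly_eq0 size_polyDl ?size_polyXn // size_polyN size_polyX //.
have mem_s x : (x \in s) = (x ^+ (p ^ N) == x).
  rewrite -subr_eq0 -root_prod_XsubC -(rootZ _ _ (_ : lead_coef P != 0)) ?lead_coef_eq0
    // -sE.
  by rewrite /root !hornerE.
exists s; last by move=> a /Ncs; rewrite mem_s => /eqP.
split; rewrite ?mem_s.
- by rewrite expr0n expn_eq0 -leqn0 leqNgt prime_gt0.
- by rewrite expr1n.
- by move=> x y; rewrite !mem_s exprDn_pchar // => /eqP-> /eqP->.
- by move=> x y; rewrite !mem_s exprMn => /eqP-> /eqP->.
- by move=> x; rewrite !mem_s exprVn => /eqP->.
Qed.

(** * First-order formulas with constants in the base field *)

Lemma subset_cat (T : eqType) (s s' r : seq T) : {subset s ++ s' <= r} ->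
  {subset s <= r} /\ {subset s' <= r}.
Proof. by move=> sr; split=> z zin; apply: sr; rewrite mem_cat zin ?orbT. Qed.

Section Formulas.
Variable C : closedFieldType.

(* [mconst] is not required to be a ring morphism: a formula only sees finitely
   many constants, whose algebraic relations may be stated in it. *)
Record model := Model { mfield :> closedFieldType; mconst : C -> mfield }.

(* [TVar k j] is the [j]-th coordinate of the [k]-th point. *)
Inductive term :=
  | TVar of nat & nat
  | TConst of C
  | TZero
  | TOne
  | TAdd of term & term
  | TMul of term & term.

Inductive formula :=
  | FEq of term & term
  | FAnd of formula & formula
  | FNot of formula.

Definition env (m : model) := nat -> nat -> m.

Fixpoint teval (m : model) (e : env m) (t : term) : m :=
  match t with
  | TVar k j => e k j
  | TConst c => mconst m c
  | TZero => 0
  | TOne => 1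
  | TAdd t u => teval e t + teval e u
  | TMul t u => teval e t * teval e u
  end.

Fixpoint feval (m : model) (e : env m) (f : formula) : bool :=
  match f with
  | FEq t u => teval e t == teval e u
  | FAnd f g => feval e f && feval e g
  | FNot f => ~~ feval e f
  end.

Fixpoint tvars (t : term) : seq (nat * nat) :=
  match t with
  | TVar k j => [:: (k, j)]
  | TAdd t u | TMul t u => tvars t ++ tvars u
  | _ => [::]
  end.

Fixpoint fvars (f : formula) : seq (nat * nat) :=
  match f with
  | FEq t u => tvars t ++ tvars u
  | FAnd f g => fvars f ++ fvars g
  | FNot f => fvars f
  end.

Fixpoint tconsts (t : term) : seq C :=
  match t with
  | TConst c => [:: c]
  | TAdd t u | TMul t u => tconsts t ++ tconsts u
  | _ => [::]
  end.

Fixpoint fconsts (f : formula) : seq C :=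
  match f with
  | FEq t u => tconsts t ++ tconsts u
  | FAnd f g => fconsts f ++ fconsts g
  | FNot f => fconsts f
  end.

Lemma eq_teval (F : closedFieldType) (r r' : C -> F) (e e' : nat -> nat -> F) t :
  {in tconsts t, r =1 r'} -> (forall v, v \in tvars t -> e v.1 v.2 = e' v.1 v.2) ->
  teval (m := Model r) e t = teval (m := Model r') e' t.
Proof.
elim: t => //= [k j _ /(_ (k, j))|c rr' _|t IHt u IHu rr' ee'|t IHt u IHu rr' ee'].
- by apply; rewrite mem_head.
- by apply: rr'; rewrite mem_head.
- by rewrite IHt ?IHu // => z zin; (apply: rr' || apply: ee'); rewrite mem_cat zin ?orbT.
- by rewrite IHt ?IHu // => z zin; (apply: rr' || apply: ee'); rewrite mem_cat zin ?orbT.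
Qed.

Lemma eq_feval (F : closedFieldType) (r r' : C -> F) (e e' : nat -> nat -> F) f :
  {in fconsts f, r =1 r'} -> (forall v, v \in fvars f -> e v.1 v.2 = e' v.1 v.2) ->
  feval (m := Model r) e f = feval (m := Model r') e' f.
Proof.
elim: f => /= [t u|f IHf g IHg|f IHf] rr' ee'; last by rewrite IHf.
- by congr (_ == _); apply: eq_teval => z zin; (apply: rr' || apply: ee');
  rewrite mem_cat zin ?orbT.
- by rewrite IHf ?IHg // => z zin; (apply: rr' || apply: ee'); rewrite mem_cat zin ?orbT.
Qed.

(** * Formulas as conditions on integer polynomials *)

Section Flatten.
Variables (cs : seq C) (vs : seq (nat * nat)).
Let k := size cs.
Let l := size vs.

(** The constants of a formula become unknowns: the first [k] variables stand for the elements of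
    [cs], the next [l] for those of [vs]. *)
Definition flat_const (F : closedFieldType) (e : nat -> F) : C -> F :=
  fun c => e (index c cs).

Definition flat_env (F : closedFieldType) (e : nat -> F) : nat -> nat -> F :=
  fun a b => e (k + index (a, b) vs)%N.

Fixpoint flat_term (t : term) : Zpoly (k + l) :=
  match t with
  | TVar a b => Zvar (k + l) (k + index (a, b) vs)
  | TConst c => Zvar (k + l) (index c cs)
  | TZero => 0
  | TOne => 1
  | TAdd t u => flat_term t + flat_term u
  | TMul t u => flat_term t * flat_term u
  end.

Lemma flat_termP (F : closedFieldType) (e : nat -> F) t :
  {subset tconsts t <= cs} -> {subset tvars t <= vs} ->
  Zeval e (k + l) (flat_term t) = teval (m := Model (flat_const e)) (flat_env e) t.
Proof.
elim: t => [a b|c|||t IHt u IHu|t IHt u IHu]; rewrite ?rmorph0 ?rmorph1 //.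
- move=> _ /(_ (a, b) (mem_head _ _)) ab.
  by rewrite /flat_term ieval_var // ltn_add2l index_mem.
- move=> /(_ c (mem_head _ _)) cin _.
  by rewrite /flat_term ieval_var // ltn_addr // index_mem.
- by move=> /= /subset_cat[c1 c2] /subset_cat[v1 v2]; rewrite rmorphD IHt ?IHu.
- by move=> /= /subset_cat[c1 c2] /subset_cat[v1 v2]; rewrite rmorphM IHt ?IHu.
Qed.

Lemma flat_form_constructible f :
  {subset fconsts f <= cs} -> {subset fvars f <= vs} ->
  Zconstructible (k + l) (fun F e => feval (m := Model (flat_const e)) (flat_env e) f).
Proof.
elim: f => [t u|f IHf g IHg|f IHf] /=.
- move=> /subset_cat[c1 c2] /subset_cat[v1 v2].
  have [d dP] := constructible_eq0 (flat_term t - flat_term u).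
  exists d => F e; rewrite -dP rmorphB !flat_termP //.
  by split=> [/eqP->|/eqP]; rewrite ?subrr // subr_eq0.
- move=> /subset_cat[c1 c2] /subset_cat[v1 v2]; have [d dP] := IHf c1 v1;
  have [d' dP'] := IHg c2 v2.
  have [||d'' dP''] := @constructible_and _ (fun F ev => dnf_holds ev d)
    (fun F ev => dnf_holds ev d').
  + by exists d.
  + by exists d'.
  by exists d'' => F e; rewrite -dP'' -dP -dP'; split=> /andP.
- move=> c v; have [d dP] := Zconstructible_not (IHf c v).
  by exists d => F e; rewrite -dP; split=> /negP.
Qed.

End Flatten.

(** * Specializations of the constants to finite fields *)

Record specialization := Specialization {
  specialization_p : nat;
  specialization_field : seq (Fp_closure specialization_p);
  specialization_const : C -> Fp_closure specialization_p;
  specialization_fieldP : subfield_seq specialization_field;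
  specialization_constP : forall c, specialization_const c \in specialization_field }.

(** Formulas are interpreted over the whole algebraic closure, where elimination applies. The finite
    subfield serves to count points, and contains all the constants so that polynomial maps preserve
    it. *)
Definition specialization_model (i : specialization) : model :=
  Model (@specialization_const i).

Definition base_model : model := Model (@id C).

Lemma transfer (f : formula) : [pchar C] =i pred0 ->
  (forall e : env base_model, feval e f) ->
  exists i : specialization, forall e : env (specialization_model i), feval e f.
Proof.
move=> C0 fC; pose cs := undup (fconsts f); pose vs := undup (fvars f).
have csP : {subset fconsts f <= cs} by move=> c; rewrite mem_undup.
have vsP : {subset fvars f <= vs} by move=> c; rewrite mem_undup.
set k := size cs; set l := size vs.
have [||p pr [c' Pc']] := lefschetz C0 (flat_form_constructible csP vsP).
- move=> F e e' ee'; congr is_true; apply: eq_feval => [c /csP|[a b] /vsP] cin.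
    by rewrite /flat_const ee' // ltn_addr // index_mem.
  by rewrite /flat_env ee' // ltn_add2l index_mem.
- exists (nth 0 cs) => x; set x' := overwrite _ _ _ _.
  have := fC (flat_env cs vs x'); congr is_true; apply: eq_feval => // c /csP cin.
  by rewrite /flat_const /x' /overwrite leqNgt index_mem cin /= nth_index.
(* Constants that do not occur in [f] are sent to 0, so that all the values lie in one finite
   subfield. *)
pose r c := if c \in cs then c' (index c cs) else 0.
have [s s_sub s_c] := Fp_closure_subfield [seq r c | c <- cs] pr.
have rP c : r c \in s.
  rewrite {1}/r; case: ifP => cin; last by have [] := s_sub.
  by apply: s_c; apply/mapP; exists c; rewrite // /r cin.
exists (Specialization s_sub rP) => e.
have := Pc' (fun i => let v := nth (0, 0)%N vs (i - k) in e v.1 v.2).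
congr is_true; apply: eq_feval => [c /csP cin|[a b] /vsP vin].
  by rewrite /flat_const /overwrite leqNgt index_mem cin /= /r cin.
rewrite /flat_env /overwrite leq_addr ltn_add2l index_mem vin /=.
by rewrite addKn nth_index.
Qed.

(** A filter of specializations, generated by the universal sentences that are true over [C]. In
    characteristic 0 it is proper, by [eventually_exists]. *)
Definition eventually (T : specialization -> Prop) :=
  exists2 f, forall e : env base_model, feval e f &
    forall i, (forall e : env (specialization_model i), feval e f) -> T i.

Lemma eventually_exists T : [pchar C] =i pred0 -> eventually T -> exists i, T i.
Proof. by move=> C0 [f /(transfer C0)[i fi] fT]; exists i; apply: fT. Qed.

Lemma eventually_true (T : specialization -> Prop) : (forall i, T i) -> eventually T.
Proof. by move=> h; exists (FEq TZero TZero) => // e /=. Qed.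

Lemma eventually_and T U : eventually T -> eventually U ->
  eventually (fun i => T i /\ U i).
Proof.
move=> [f fC fT] [g gC gU]; exists (FAnd f g) => [e|i fg] /=; first by rewrite fC gC.
by split; [apply: fT|apply: gU] => e; have /andP[] := fg e.
Qed.

Lemma eventually_mono (T U : specialization -> Prop) :
  (forall i, T i -> U i) -> eventually T -> eventually U.
Proof. by move=> TU [f fC fT]; exists f => // i /fT/TU. Qed.

Lemma eventually_forall_in (J : eqType) (s : seq J) (T : J -> specialization -> Prop) :
  (forall j, eventually (T j)) -> eventually (fun i => forall j, j \in s -> T j i).
Proof.
move=> eT; elim: s => [|j s IH]; first exact: eventually_true.
apply: eventually_mono (eventually_and (eT j) IH) => i [Tj Ts] j'.
by rewrite in_cons => /predU1P[->|/Ts].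
Qed.

Lemma eventually_forall (J : finType) (T : J -> specialization -> Prop) :
  (forall j, eventually (T j)) -> eventually (fun i => forall j, T j i).
Proof.
move=> /(eventually_forall_in (enum J)); apply: eventually_mono => i h j.
by apply: h; rewrite mem_enum.
Qed.

(** * Properties defined by one formula in all models *)

Definition definable (P : forall m, env m -> bool) :=
  exists f, forall m (e : env m), P m e = feval e f.

Definition tdefinable (t : forall m, env m -> m) :=
  exists u, forall m (e : env m), t m e = teval e u.

Lemma eventually_definable P : definable P -> (forall e : env base_model, P _ e) ->
  eventually (fun i => forall e : env (specialization_model i), P _ e).
Proof. by move=> [f fP] PC; exists f => [e|i fi e]; rewrite -?fP // fP. Qed.

Lemma definable_eq t u : tdefinable t -> tdefinable u ->
  definable (fun m e => t m e == u m e).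
Proof. by move=> [t' tP] [u' uP]; exists (FEq t' u') => m e; rewrite tP uP. Qed.

Lemma definable_and P Q : definable P -> definable Q ->
  definable (fun m e => P m e && Q m e).
Proof. by move=> [f fP] [g gP]; exists (FAnd f g) => m e; rewrite fP gP. Qed.

Lemma definable_not P : definable P -> definable (fun m e => ~~ P m e).
Proof. by move=> [f fP]; exists (FNot f) => m e; rewrite fP. Qed.

Lemma definable_ext P Q : (forall m (e : env m), P m e = Q m e) ->
  definable P -> definable Q.
Proof. by move=> PQ [f fP]; exists f => m e; rewrite -PQ. Qed.

Lemma definable_or P Q : definable P -> definable Q ->
  definable (fun m e => P m e || Q m e).
Proof.
move=> dP dQ; apply: definable_ext
  (definable_not (definable_and (definable_not dP) (definable_not dQ))).
by move=> m e; rewrite negb_and !negbK.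
Qed.

Lemma definable_imply P Q : definable P -> definable Q ->
  definable (fun m e => P m e ==> Q m e).
Proof.
move=> dP dQ; apply: definable_ext (definable_or (definable_not dP) dQ).
by move=> m e; rewrite implybE.
Qed.

Lemma definable_const b : definable (fun m e => b).
Proof.
by case: b; [exists (FEq TZero TZero)|exists (FNot (FEq TZero TZero))] => m e /=;
  rewrite eqxx.
Qed.

Lemma definable_all J (s : seq J) (P : J -> forall m, env m -> bool) :
  (forall j, definable (P j)) -> definable (fun m e => all (fun j => P j m e) s).
Proof.
by move=> dP; elim: s => [|j s IH] /=; [apply: definable_const|apply: definable_and].
Qed.

Lemma definable_has J (s : seq J) (P : J -> forall m, env m -> bool) :
  (forall j, definable (P j)) -> definable (fun m e => has (fun j => P j m e) s).
Proof.
by move=> dP; elim: s => [|j s IH] /=; [apply: definable_const|apply: definable_or].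
Qed.

Lemma definable_forall (J : finType) (P : J -> forall m, env m -> bool) :
  (forall j, definable (P j)) -> definable (fun m e => [forall j, P j m e]).
Proof.
move=> /(definable_all (enum J)); apply: definable_ext => m e.
apply/allP/forallP => h j; last by [].
by apply: h; rewrite mem_enum.
Qed.

Lemma definable_exists (J : finType) (P : J -> forall m, env m -> bool) :
  (forall j, definable (P j)) -> definable (fun m e => [exists j, P j m e]).
Proof.
move=> /(definable_has (enum J)); apply: definable_ext => m e.
apply/hasP/existsP => [[j _ Pj]|[j Pj]]; first by exists j.
by exists j; rewrite ?mem_enum.
Qed.

(** Any Boolean function of finitely many definable properties is a disjunction over the rows of its
    truth table. *)
Lemma definable_ffun (J : finType) (P : J -> forall m, env m -> bool)
    (h : {ffun J -> bool} -> bool) :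
  (forall j, definable (P j)) -> definable (fun m e => h [ffun j => P j m e]).
Proof.
move=> dP; have : definable (fun m e =>
    [exists b : {ffun J -> bool}, h b && [forall j, P j m e == b j]]).
  apply: definable_exists => b; apply: definable_and; first exact: definable_const.
  apply: definable_forall => j; case: (b j).
    by apply: definable_ext (dP j) => m e; rewrite eqb_id.
  by apply: definable_ext (definable_not (dP j)) => m e; rewrite eqbF_neg.
apply: definable_ext => m e; apply/existsP/idP => [[b /andP[hb /forallP bE]]|hP].
  by suff -> : [ffun j => P j m e] = b by []; apply/ffunP => j; rewrite ffunE; apply/eqP.
by exists [ffun j => P j m e]; rewrite hP; apply/forallP => j; rewrite ffunE.
Qed.

Lemma tdefinable_var k j : tdefinable (fun m e => e k j).
Proof. by exists (TVar k j). Qed.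

Lemma tdefinable_const c : tdefinable (fun m e => mconst m c).
Proof. by exists (TConst c). Qed.

Lemma tdefinable_0 : tdefinable (fun m e => 0).
Proof. by exists TZero. Qed.

Lemma tdefinable_1 : tdefinable (fun m e => 1).
Proof. by exists TOne. Qed.

Lemma tdefinable_mul t u : tdefinable t -> tdefinable u ->
  tdefinable (fun m e => t m e * u m e).
Proof. by move=> [t' tP] [u' uP]; exists (TMul t' u') => m e; rewrite tP uP. Qed.

Lemma tdefinable_exp t n : tdefinable t -> tdefinable (fun m e => t m e ^+ n).
Proof.
move=> dt; elim: n => [|n [u uP]]; first exact: tdefinable_1.
have [t' tP] := dt; exists (TMul t' u) => m e; by rewrite exprS uP tP.
Qed.

Lemma tdefinable_sum J (s : seq J) (t : J -> forall m, env m -> m) :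
  (forall j, tdefinable (t j)) -> tdefinable (fun m e => \sum_(j <- s) t j m e).
Proof.
move=> dt; elim: s => [|j s [u uP]]; first by exists TZero => m e; rewrite big_nil.
by have [t' tP] := dt j; exists (TAdd t' u) => m e; rewrite big_cons tP uP.
Qed.

Lemma tdefinable_prod J (s : seq J) (t : J -> forall m, env m -> m) :
  (forall j, tdefinable (t j)) -> tdefinable (fun m e => \prod_(j <- s) t j m e).
Proof.
move=> dt; elim: s => [|j s [u uP]]; first by exists TOne => m e; rewrite big_nil.
by have [t' tP] := dt j; exists (TMul t' u) => m e; rewrite big_cons tP uP.
Qed.

End Formulas.

(** * Noetherianity *)

Section Noetherian.

Lemma image_seq_lift (T U : eqType) (f : T -> U) (S : set T) (t : seq U) :
  [set` t] `<=` f @` S -> exists2 s : seq T, [set` s] `<=` S & {subset t <= map f s}.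
Proof.
elim: t => [|a t IH] tS; first by exists [::].
have [q Sq qa] := tS a (mem_head _ _).
have [b bt|s sS st] := IH; first by apply: tS; rewrite /= in_cons bt orbT.
exists (q :: s) => [z /=|b]; first by rewrite in_cons => /predU1P[->|/sS].
by rewrite /= !in_cons -qa => /predU1P[->|/st ->]; rewrite ?eqxx ?orbT.
Qed.

Inductive ideal_of (R : comNzRingType) (S : set R) : R -> Prop :=
  | Ideal_mem x : S x -> ideal_of S x
  | Ideal_0 : ideal_of S 0
  | Ideal_add x y : ideal_of S x -> ideal_of S y -> ideal_of S (x + y)
  | Ideal_mul a x : ideal_of S x -> ideal_of S (a * x).

Lemma ideal_of_trans (R : comNzRingType) (S T : set R) :
  S `<=` ideal_of T -> ideal_of S `<=` ideal_of T.
Proof.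
move=> ST x; elim=> {x} [x /ST//||x y _ Ix _ Iy|a x _ Ix].
- exact: Ideal_0.
- exact: Ideal_add.
- exact: Ideal_mul.
Qed.

Lemma ideal_of_finite (R : comNzRingType) (S : set R) x : ideal_of S x ->
  exists2 s : seq R, [set` s] `<=` S & ideal_of [set` s] x.
Proof.
have mono (s s' : seq R) : {subset s <= s'} -> ideal_of [set` s] `<=` ideal_of [set` s'].
  by move=> ss'; apply: ideal_of_trans => y /ss' ys; apply: Ideal_mem.
elim=> {x} [x Sx||x y _ [s sS Ix] _ [s' sS' Iy]|a x _ [s sS Ix]].
- exists [:: x]; first by move=> y /=; rewrite inE => /eqP->.
  by apply: Ideal_mem; rewrite /= mem_head.
- by exists [::] => //; apply: Ideal_0.
- exists (s ++ s'); first by move=> z /=; rewrite mem_cat => /orP[/sS|/sS'].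
  by apply: Ideal_add; [move: Ix|move: Iy]; apply: mono => z zin;
    rewrite mem_cat zin ?orbT.
- by exists s => //; apply: Ideal_mul.
Qed.

Lemma ideal_of_finite_seq (R : comNzRingType) (S : set R) (t : seq R) :
  [set` t] `<=` ideal_of S ->
  exists2 s : seq R, [set` s] `<=` S & [set` t] `<=` ideal_of [set` s].
Proof.
elim: t => [|x t IH] tI; first by exists [::].
have [y yt|s sS ts] := IH; first by apply: tI; rewrite /= in_cons yt orbT.
have [|s' sS' xs'] := ideal_of_finite (tI x _); first by rewrite /= mem_head.
exists (s ++ s'); first by move=> z /=; rewrite mem_cat => /orP[/sS|/sS'].
move=> y /=; rewrite in_cons => /predU1P[->|/ts]; [move: xs'|];
  by apply: ideal_of_trans => z zs; apply: Ideal_mem; rewrite /= mem_cat zs ?orbT.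
Qed.

Definition noetherian (R : comNzRingType) := forall S : set R,
  exists2 s : seq R, [set` s] `<=` S & S `<=` ideal_of [set` s].

Lemma field_noetherian (F : fieldType) : noetherian F.
Proof.
move=> S; have [[x Sx x0]|nS] := pselect (exists2 x, S x & x != 0).
  exists [:: x] => [y /=|y _]; first by rewrite inE => /eqP->.
  rewrite -[y](divfK x0); apply: Ideal_mul; apply: Ideal_mem; exact: mem_head.
exists [::] => // x Sx; have [->|x0] := eqVneq x 0; first exact: Ideal_0.
by case: nS; exists x.
Qed.

(** Multiplication by powers of ['X] brings all leading coefficients to degree [M.-1], where a
    linear combination of them can be formed. The result [a] may be 0, so the size of [g] is only
    bounded. *)
Lemma ideal_lead_coef (R : comNzRingType) (s : seq {poly R}) M a : (0 < M)%N ->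
  (forall q, q \in s -> (size q <= M)%N) ->
  ideal_of [set lead_coef q | q in [set` s]] a ->
  exists g, [/\ ideal_of [set` s] g, (size g <= M)%N & g`_M.-1 = a].
Proof.
move=> M0 leM; elim=> {a} [_ [q /= qs <-]||a b _ [g [Ig lg <-]] _ [h [Ih lh <-]]|c a _
  [g [Ig lg <-]]].
- have [->|q0] := eqVneq q 0.
    by exists 0; rewrite size_poly0 coef0 lead_coef0; split=> //; apply: Ideal_0.
  have sq : (0 < size q)%N by rewrite size_poly_gt0.
  exists ('X^(M - size q) * q); split.
  + by apply: Ideal_mul; apply: Ideal_mem.
  + by rewrite mulrC size_Mmonic ?monicXn // size_polyXn addnS /= subnKC ?leM.
  + rewrite coefXnM lead_coefE; have le := leM q qs.
    have -> : (M.-1 = (M - size q) + (size q).-1)%N by lia.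
    by rewrite ltnNge leq_addr addKn.
- by exists 0; rewrite size_poly0 coef0; split=> //; apply: Ideal_0.
- exists (g + h); rewrite coefD; split=> //; first exact: Ideal_add.
  by apply: leq_trans (size_polyD _ _) _; rewrite geq_max lg lh.
- exists (c%:P * g); rewrite coefCM; split=> //; first exact: Ideal_mul.
  by rewrite mul_polyC; apply: leq_trans (size_scale_leq _ _) lg.
Qed.

(** The leading coefficients of [G] generate those of the whole ideal [I], and the ones of [H m]
    those of its elements of size [m]. An element of size above [N] is reduced by means of [G], a
    smaller one by means of the [H m] of its own size: subtracting a combination with the same top
    term lowers the size. *)
Theorem hilbert_basis (R : comNzRingType) : noetherian R -> noetherian {poly R}.
Proof.
move=> noeR S; pose I := ideal_of S.
have lift (T : set {poly R}) : exists2 s : seq {poly R}, [set` s] `<=` T &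
    [set lead_coef q | q in T] `<=` ideal_of [set lead_coef q | q in [set` s]].
  have [t tT Tt] := noeR [set lead_coef q | q in T].
  have [s sT st] := image_seq_lift tT.
  exists s => // a /Tt; apply: ideal_of_trans => b /st /mapP[q qs ->].
  by apply: Ideal_mem; exists q.
have [G GI GT] := lift I.
pose N := (\max_(q <- G) size q)%N.
have leN q : q \in G -> (size q <= N)%N by move=> qG; apply: (leq_bigmax_seq q).
have [H HP] := choice (fun m => let: ex_intro2 s p q := lift [set q | I q /\ size q = m]
   in ex_intro (fun s : seq {poly R} => _ /\ _) s (conj p q)).
pose B := G ++ flatten [seq H m | m <- iota 0 N.+1].
have BI : [set` B] `<=` I.
  move=> q /=; rewrite mem_cat => /orP[/GI//|/flatten_mapP[m _]].
  by have [/(_ q) + _] := HP m => h /h [].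
have [s sS Bs] := ideal_of_finite_seq BI; exists s => // f Sf.
suff IB g : I g -> ideal_of [set` B] g by apply: (ideal_of_trans Bs); apply/IB/Ideal_mem.
have [m] := ubnP (size g); elim: m g => // m IHm g; rewrite ltnS => le_m Ig.
have [->|g0] := eqVneq g 0; first exact: Ideal_0.
have sg : (0 < size g)%N by rewrite size_poly_gt0.
have [t [tB let_ ta]] : exists t : seq {poly R}, [/\ {subset t <= B},
    forall q, q \in t -> (size q <= size g)%N &
    ideal_of [set lead_coef q | q in [set` t]] (lead_coef g)].
  have [leg|ltg] := leqP (size g) N.
    have [Hg Hl] := HP (size g); exists (H (size g)); split.
    - move=> q qH; rewrite mem_cat; apply/orP; right; apply/flatten_mapP.
      by exists (size g) => //; rewrite mem_iota add0n ltnS.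
    - by move=> q /Hg [_ ->].
    - by apply: Hl; exists g.
  exists G; split.
  - by move=> q qG; rewrite mem_cat qG.
  - by move=> q /leN le; apply: leq_trans le (ltnW ltg).
  - by apply: GT; exists g.
have [h [Ih sh hl]] := ideal_lead_coef sg let_ ta.
have Bh : ideal_of [set` B] h by move: Ih; apply: ideal_of_trans => q /tB qB; apply:
  Ideal_mem.
rewrite -[g](subrK h); apply: Ideal_add => //; apply: IHm; last first.
  rewrite -mulN1r; apply: Ideal_add => //; apply: Ideal_mul.
  exact: (ideal_of_trans BI).
apply: (@leq_ltn_trans (size g).-1); last first.
  by apply: leq_trans le_m; rewrite (ltn_predL (size g)).
apply/leq_sizeP => j; rewrite leq_eqVlt coefB => /predU1P[<-|lt_j].
  by rewrite hl lead_coefE subrr.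
have le_j : (size g <= j)%N by rewrite -(ltn_predK sg).
by rewrite !nth_default ?subrr // (leq_trans sh).
Qed.

Lemma ipoly_noetherian (F : fieldType) k : noetherian (ipoly F k).
Proof. by elim: k => [|k IH]; [apply: field_noetherian|apply: hilbert_basis]. Qed.

Lemma ideal_of_root (R F : comNzRingType) (f : {rmorphism R -> F}) (S : set R) :
  (forall x, S x -> f x = 0) -> forall x, ideal_of S x -> f x = 0.
Proof.
move=> S0 x; elim=> {x} [x /S0//||x y _ fx _ fy|a x _ fx].
- by rewrite rmorph0.
- by rewrite rmorphD fx fy addr0.
- by rewrite rmorphM fx mulr0.
Qed.

(** Finitely many elements of [S] generate all of it up to ideals, by the basis theorem for iterated
    univariate polynomials, to which [T] carries multivariate ones compatibly with evaluation. *)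
Lemma mpoly_finite_zeros (F : fieldType) n (S : set {mpoly F[n]}) :
  exists2 s : seq {mpoly F[n]}, [set` s] `<=` S &
    forall x : 'I_n -> F, (forall p, p \in s -> p.@[x] = 0) -> forall p, S p -> p.@[x] =
      0.
Proof.
pose T (p : {mpoly F[n]}) : ipoly F n :=
  \sum_(m <- msupp p) iconst n p@_m * \prod_(i < n) ivar F n i ^+ m i.
have TE (x : 'I_n -> F) p : p.@[x] =
    ieval idfun (fun i => if insub i is Some i' then x i' else 0) n (T p).
  rewrite mevalE rmorph_sum; apply: eq_bigr => m _; rewrite rmorphM ieval_const /=.
  congr (_ * _); rewrite rmorph_prod; apply: eq_bigr => i _.
  by rewrite rmorphXn /= ieval_var // valK.
have [t tS St] := @ipoly_noetherian F n [set T p | p in S].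
have [s sS st] := image_seq_lift tS.
exists s => // x sx p Sp; rewrite TE; apply: (ideal_of_root (S := [set` t])).
  by move=> y /st /mapP[q qs ->]; rewrite -TE sx.
by apply: St; exists p.
Qed.

End Noetherian.

(** * Counting points over finite fields *)

Lemma subfield_seq_sum (F : fieldType) (s : seq F) J (r : seq J) (f : J -> F) :
  subfield_seq s -> (forall j, f j \in s) -> \sum_(j <- r) f j \in s.
Proof.
move=> ss fs; elim/big_ind: _ => //; [exact: subfield_seq0|exact: subfield_seqD].
Qed.

Lemma subfield_seq_prod (F : fieldType) (s : seq F) J (r : seq J) (f : J -> F) :
  subfield_seq s -> (forall j, f j \in s) -> \prod_(j <- r) f j \in s.
Proof.
move=> ss fs; elim/big_ind: _ => //; [exact: subfield_seq1|exact: subfield_seqM].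
Qed.

Lemma subfield_seqX (F : fieldType) (s : seq F) x n :
  subfield_seq s -> x \in s -> x ^+ n \in s.
Proof.
move=> ss xs; elim: n => [|n IH]; first exact: subfield_seq1.
by rewrite exprS subfield_seqM.
Qed.

Definition normalized_coords (F : fieldType) n (x : nat -> F) : bool :=
  [exists i : 'I_n.+1, (x i == 1) && [forall j : 'I_n.+1, (j < i)%N ==> (x j == 0)]].

(** Proportional nonzero vectors have their first nonzero coordinate at the same index, and here it
    is 1 in both. *)
Lemma normalized_coords_uniq (F : fieldType) n (x y : nat -> F) :
  normalized_coords n x -> normalized_coords n y ->
  (forall i j : 'I_n.+1, x i * y j = x j * y i) -> forall j : 'I_n.+1, x j = y j.
Proof.
move=> /existsP[a /andP[/eqP xa /forallP xlt]] /existsP[b /andP[/eqP yb /forallP ylt]] xy.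
have yE (j : 'I_n.+1) : y j = x j * y a by rewrite -xy xa mul1r.
have ya0 : y a != 0.
  by apply/eqP=> ya; have := yE b; rewrite yb ya mulr0 => /eqP; rewrite oner_eq0.
have xb0 : x b != 0.
  by apply/eqP=> xb; have := yE b; rewrite yb xb mul0r => /eqP; rewrite oner_eq0.
have le_ab : (a <= b)%N.
  by rewrite leqNgt; apply/negP=> lt; have := xlt b; rewrite lt (negbTE xb0).
have le_ba : (b <= a)%N.
  by rewrite leqNgt; apply/negP=> lt; have := ylt a; rewrite lt (negbTE ya0).
have eab : a = b by apply/val_inj/eqP; rewrite eqn_leq le_ab.
by move=> j; rewrite yE eab yb mulr1.
Qed.

(** The divisor is the first nonzero coordinate. That it is one of the coordinates is recorded so
    that the quotient stays in a finite subfield containing them. *)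
Lemma normalize (F : fieldType) n (z : nat -> F) : (exists i : 'I_n.+1, z i != 0) ->
  exists2 c : F, (exists i : 'I_n.+1, c = z i) & c !=
    0 /\ normalized_coords n (fun j => z j / c).
Proof.
case=> i zi; pose P k := (k < n.+1)%N && (z k != 0).
have exP : exists k, P k by exists i; rewrite /P ltn_ord.
case: (ex_minnP exP) => a /andP[lta za] amin.
exists (z a); first by exists (Ordinal lta).
split=> //; apply/existsP; exists (Ordinal lta); rewrite divff // eqxx /=.
apply/forallP => j; apply/implyP => lt_ja; rewrite mulf_eq0; apply/orP; left.
apply/negPn/negP => zj; have := amin j; rewrite /P ltn_ord zj /= => /(_ isT).
by rewrite leqNgt lt_ja.
Qed.

(** * Specialized equations and their points *)

Section Points.
Variable C : closedFieldType.

(** The value at [x] of [p] with specialized coefficients, spelled out over the monomials of [p]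
    over [C] so that it is visibly a term. *)
Definition mev (m : model C) n (p : {mpoly C[n]}) (x : nat -> m) : m :=
  \sum_(u <- msupp p) mconst m p@_u * \prod_(i < n) x i ^+ u i.

Lemma tdefinable_mev n (p : {mpoly C[n]}) k :
  tdefinable (fun m (e : env m) => mev p (e k)).
Proof.
apply: tdefinable_sum => u; apply: tdefinable_mul; first exact: tdefinable_const.
by apply: tdefinable_prod => i; apply/tdefinable_exp/tdefinable_var.
Qed.

Lemma definable_normalized_coords n k :
  definable (fun (m : model C) (e : env m) => normalized_coords n (e k)).
Proof.
apply: definable_exists => i; apply: definable_and.
  by apply: definable_eq; [apply: tdefinable_var|apply: tdefinable_1].
apply: definable_forall => j; apply: definable_imply; first exact: definable_const.
by apply: definable_eq; [apply: tdefinable_var|apply: tdefinable_0].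
Qed.

Lemma eq_mev (m : model C) n (p : {mpoly C[n]}) (x y : nat -> m) :
  (forall i, (i < n)%N -> x i = y i) -> mev p x = mev p y.
Proof.
move=> xy; apply: eq_bigr => u _; congr (_ * _); apply: eq_bigr => i _.
by rewrite xy.
Qed.

Definition coord n (x : proj C n) : nat -> base_model C :=
  fun j => if insub j is Some i then coords x 0 i else 0.

Lemma coordE n (x : proj C n) (i : 'I_n.+1) : coord x i = coords x 0 i.
Proof. by rewrite /coord valK. Qed.

Lemma mev_coord n (p : {mpoly C[n.+1]}) (x : proj C n) : mev p (coord x) = peval p x.
Proof.
rewrite /peval mevalE; apply: eq_bigr => u _; congr (_ * _).
by apply: eq_bigr => i _; rewrite coordE.
Qed.

Lemma normalized_coord n (x : proj C n) : normalized_coords n (coord x).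
Proof.
case: x => v vn; rewrite /normalized_coords; case/existsP: (vn) =>
  i /andP[vi /forallP vlt].
apply/existsP; exists i; rewrite coordE vi; apply/forallP => j; rewrite coordE; exact:
  vlt.
Qed.

Lemma normalized_coords_proj n (x : nat -> base_model C) : normalized_coords n x ->
  exists y : proj C n, forall i, (i < n.+1)%N -> x i = coord y i.
Proof.
case/existsP=> i /andP[xi /forallP xlt].
have yn : normalized (\row_(j < n.+1) x j).
  apply/existsP; exists i; rewrite mxE xi; apply/forallP => j; rewrite mxE; exact: xlt.
exists (Proj yn) => j lt_j; by rewrite -[j]/(val (Ordinal lt_j)) coordE mxE.
Qed.

Lemma proj_inj n (x y : proj C n) : coords x = coords y -> x = y.
Proof.
by case: x y => [u un] [v vn] /= uv; move: un vn; rewrite uv => un vn; congr Proj;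
  apply: bool_irrelevance.
Qed.

Definition family := forall m : model C, (nat -> m) -> bool.

(** A description fixes equations and inequations of [A], which then make sense in every model. Two
    descriptions of [A] agree over [C], hence eventually. *)
Record describes n (A : set (proj C n)) (Q : family) : Prop := Describes {
  desc_definable : forall k, definable (fun m (e : env m) => Q m (e k));
  desc_local : forall (m : model C) (x y : nat -> m),
    (forall i, (i < n.+1)%N -> x i = y i) -> Q m x = Q m y;
  desc_base : forall x, A x <-> Q (base_model C) (coord x) }.

Lemma zariski_closed_describes n (A : set (proj C n)) :
  zariski_closed A -> exists Q, describes A Q.
Proof.
case=> S _ ->; have [s sS Ss] := mpoly_finite_zeros S.
exists (fun m x => all (fun p => mev p x == 0) s); split.
- move=> k; apply: definable_all => p.
  by apply: definable_eq; [apply: tdefinable_mev|apply: tdefinable_0].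
- by move=> m x y xy; apply: eq_all => p; rewrite (eq_mev _ xy).
- move=> x; split=> [Sx|/allP sx p].
    by apply/allP => p ps; rewrite mev_coord Sx //; apply: sS.
  by apply: (Ss (fun i => coords x 0 i)) => q /sx; rewrite mev_coord => /eqP.
Qed.

Lemma describesD n (A B : set (proj C n)) : (exists Q, describes A Q) ->
  (exists Q, describes B Q) -> exists Q, describes (A `\` B) Q.
Proof.
move=> [Q [Qd Ql Qb]] [Q' [Qd' Ql' Qb']]; exists (fun m x => Q m x && ~~ Q' m x); split.
- by move=> k; apply: definable_and => //; apply: definable_not.
- by move=> m x y xy; rewrite (Ql _ _ _ xy) (Ql' _ _ _ xy).
- by move=> x; rewrite /setD /= Qb Qb'; split=> [[-> /negP]|/andP[-> /negP]].
Qed.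

Lemma loc_closed_describes n (A : set (proj C n)) :
  loc_closed A -> exists Q, describes A Q.
Proof.
by case=> B [D [cB cD ->]]; apply: describesD; apply: zariski_closed_describes.
Qed.

(* The empty family if [A] has no description. *)
Definition desc n (A : set (proj C n)) : family :=
  if pselect (exists Q, describes A Q) is left h then sval (cid h) else fun _ _ => false.

Lemma descP n (A : set (proj C n)) : (exists Q, describes A Q) -> describes A (desc A).
Proof. by rewrite /desc; case: pselect => // h _; apply: svalP. Qed.

Definition fpoint (i : specialization C) n : finType :=
  {ffun 'I_n.+1 -> seq_sub (specialization_field i)}.

Definition fcoord (i : specialization C) n (v : fpoint i n) : nat ->
  specialization_model i :=
  fun j => if insub j is Some k then val (v k) else 0.

Lemma fcoordE (i : specialization C) n (v : fpoint i n) (k : 'I_n.+1) : fcoord v k =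
  val (v k).
Proof. by rewrite /fcoord valK. Qed.

Lemma fcoord_in (i : specialization C) n (v : fpoint i n) j :
  fcoord v j \in specialization_field i.
Proof.
rewrite /fcoord; case: insub => [k|]; first exact: valP.
exact: subfield_seq0 (specialization_fieldP i).
Qed.

(* The points over the finite field of the specialized equations of [A]. *)
Definition fpoints n (A : set (proj C n)) (i : specialization C) : {set fpoint i n} :=
  [set v | normalized_coords n (fcoord v) &&
    @desc n A (specialization_model i) (fcoord v)].

Definition npoints n (A : set (proj C n)) (i : specialization C) : nat := #|fpoints A i|.

(* Double counting of the pairs (x, j) with x in [B j]. *)
Lemma npoints_weight (J : finType) n (A : set (proj C n)) (B : J -> set (proj C n)) c :
  (exists Q, describes A Q) -> (forall j, exists Q, describes (B j) Q) ->
  (forall j, B j `<=` A) -> (forall x, A x -> #|[set j | `[< B j x >]]%SET| = c) ->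
  eventually (fun i => \sum_j npoints (B j) i = c * npoints A i)%N.
Proof.
move=> /descP dA dB BA cA; have {}dB j := descP (dB j).
pose fam (o : option J) : family := if o is Some j then desc (B j) else desc A.
(* The admissible membership patterns of a point: in exactly [c] of the [B j] if it is in [A], in
   none of them otherwise. That only these occur is a universal sentence true over [C], so it holds
   pointwise after specialization. *)
pose h (b : {ffun option J -> bool}) :=
  if b None then #|[set j | b (Some j)]%SET| == c else [forall j, ~~ b (Some j)].
pose P m (e : env m) := normalized_coords n (e 0%N) ==> h [ffun o => fam o m (e 0%N)].
have Pd : definable P.
  apply: definable_imply; first exact: definable_normalized_coords.
  by apply: definable_ffun => -[j|];
    [apply: (desc_definable (dB j))|apply: (desc_definable dA)].
have PC (e : env (base_model C)) : P _ e.
  apply/implyP => /normalized_coords_proj[x xE]; rewrite /h ffunE /= (desc_local dA xE).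
  have jE j : [ffun o => fam o (base_model C) (e 0%N)] (Some j) = `[< B j x >].
    rewrite ffunE /= (desc_local (dB j) xE); apply/idP/asboolP => /(desc_base (dB j)) //.
  case: ifP => [/(desc_base dA)/cA <-|nA].
    by apply/eqP; apply: eq_card => j; rewrite !inE jE.
  apply/forallP => j; rewrite jE; apply/asboolP => /BA/(desc_base dA).
  by rewrite nA.
apply: eventually_mono (eventually_definable Pd PC) => i iP.
have cardE (D : set (proj C n)) : npoints D i =
    (\sum_(v : fpoint i n) (normalized_coords n (fcoord v) &&
      @desc n D (specialization_model i) (fcoord v)))%N.
  by rewrite /npoints -sum1_card big_mkcond; apply: eq_bigr => v _; rewrite inE.
under eq_bigr do rewrite cardE.
rewrite cardE exchange_big big_distrr /=; apply: eq_bigr => v _.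
have := iP (fun _ => fcoord v); rewrite /P.
case: (normalized_coords n (fcoord v)) => /=; last by rewrite muln0 big1.
rewrite /h ffunE /=; case: ifP => [_ /eqP <-|_ /forallP h0].
  rewrite muln1 -sum1_card [RHS]big_mkcond; apply: eq_bigr => j _.
  by rewrite inE ffunE.
by rewrite muln0 big1 // => j _; have := h0 j; rewrite ffunE => /negbTE /= ->.
Qed.

Lemma mev_in (i : specialization C) n (p : {mpoly C[n]})
  (x : nat -> specialization_model i) :
  (forall j, x j \in specialization_field i) -> mev p x \in specialization_field i.
Proof.
move=> xs; have ss := specialization_fieldP i; apply: subfield_seq_sum => // u.
apply: subfield_seqM => //; first exact: specialization_constP.
by apply: subfield_seq_prod => // j; apply: subfield_seqX.
Qed.

(** Compactness of [A]: the components of all the local expressions of [f] have no common zero on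
    [A], hence finitely many of them have none. [F p] is a tuple in which [p] occurs. *)
Lemma regular_finite n m (A : set (proj C n)) (f : proj C n -> proj C m) :
  regular_on A f -> exists (s : seq {mpoly C[n.+1]})
    (F : {mpoly C[n.+1]} -> 'I_m.+1 -> {mpoly C[n.+1]}),
    (forall p, p \in s -> forall y, A y -> exists c, forall j, peval (F p j) y =
      c * coords (f y) 0 j) /\
    (forall x, A x -> exists2 p, p \in s & exists j, peval (F p j) x != 0).
Proof.
move=> reg.
pose good (G : 'I_m.+1 -> {mpoly C[n.+1]}) :=
  forall y, A y -> exists c, forall j, peval (G j) y = c * coords (f y) 0 j.
pose S := [set p | exists G, good G /\ exists j, G j = p].
have [s sS Ss] := mpoly_finite_zeros S.
have /choice[F FP] : forall p, exists G : 'I_m.+1 -> {mpoly C[n.+1]},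
    S p -> good G /\ exists j, G j = p.
  move=> p; have [Sp|nSp] := pselect (S p); last by exists (fun=> 0).
  by have [G GP] := Sp; exists G.
exists s, F; split=> [p ps|x Ax]; first by have [] := FP p (sS p ps).
apply: contrapT => nx.
have [d [G [_ [j Gj] Gy]]] := reg x Ax.
case/eqP: Gj; apply: (Ss (fun i => coords x 0 i)); last by exists G; split=> //; exists j.
move=> p ps; apply/eqP/negPn/negP => px; apply: nx; exists p => //.
by have [_ [k Fk]] := FP p (sS p ps); exists k; rewrite Fk.
Qed.

(** As in the Ax-Grothendieck argument: finitely many polynomial tuples represent [f], and that they
    map [A] injectively to [B] is a universal sentence, which persists after specialization and
    yields an injection between finite sets of points. *)
Lemma npoints_le n m (A : set (proj C n)) (B : set (proj C m))
  (f : proj C n -> proj C m) :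
  (exists Q, describes A Q) -> (exists Q, describes B Q) -> regular_on A f ->
  (forall x, A x -> B (f x)) -> (forall x y, A x -> A y -> f x = f y -> x = y) ->
  eventually (fun i => npoints A i <= npoints B i)%N.
Proof.
move=> /descP dA /descP dB reg AB finj.
have [s [F [Fy Fx]]] := regular_finite reg.
pose nz p (M : model C) (x : nat -> M) := [exists j, mev (m := M) (F p j) x != 0].
(* The graph of [f] as seen by [F p]: the vector [y] is proportional to the nonzero vector [F p] at
   [x]. *)
pose T p (M : model C) (x y : nat -> M) := nz p M x &&
  [forall j : 'I_m.+1, [forall k : 'I_m.+1, mev (m := M) (F p j) x * y k ==
    mev (F p k) x * y j]].
pose inA (M : model C) (x : nat -> M) := normalized_coords n x && @desc n A M x.
have inA_base (x : nat -> base_model C) : inA _ x ->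
    exists2 y, A y & forall i, (i < n.+1)%N -> x i = coord y i.
  case/andP=> /normalized_coords_proj[y yE]; rewrite (desc_local dA yE) =>
    /(desc_base dA) Ay.
  by exists y.
have T_base p x y : p \in s -> inA (base_model C) x -> normalized_coords m y ->
  T p (base_model C) x y ->
    exists2 x', A x' & (forall i, (i < n.+1)%N -> x i = coord x' i) /\
     (forall i, (i < m.+1)%N -> y i = coord (f x') i).
  move=> ps /inA_base[x' Ax' xE] yn /andP[/existsP[j0 nzj] /forallP Tp]; exists x' =>
    //; split=> //.
  have [c cE] := Fy p ps x' Ax'.
  have FE j : mev (m := base_model C) (F p j) x = c * coord (f x') j.
    by rewrite (eq_mev _ xE) mev_coord cE coordE.
  (* A local expression may vanish identically at some points of [A]; [nz] excludes this here, so
     that [y] is proportional to the value of [f] and, both being normalized, equal to it. *)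
  have c0 : c != 0 by apply: contraNneq nzj => c0; rewrite FE c0 mul0r.
  move=> j lt_j; symmetry; rewrite -[j]/(val (Ordinal lt_j)).
  apply: (normalized_coords_uniq (normalized_coord _) yn) => a b.
  apply: (mulfI c0); rewrite !mulrA -!FE.
  by have /forallP/(_ b)/eqP := Tp a.
(* The three sentences to transfer: some tuple is nonzero at each point of [A], values lie in [B],
   and equal values, even through different tuples, come from equal points. Points 0 and 2 of the
   environment are arguments, point 1 is a value. *)
pose P1 (M : model C) (e : env M) := inA M (e 0%N) ==> has (fun p => nz p M (e 0%N)) s.
pose P2 (M : model C) (e : env M) := all (fun p =>
  [&& inA M (e 0%N), normalized_coords m (e 1%N) & T p M (e 0%N) (e 1%N)] ==>
    @desc m B M (e 1%N)) s.
pose P3 (M : model C) (e : env M) := all (fun p => all (fun q =>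
  [&& inA M (e 0%N), inA M (e 2%N), normalized_coords m (e 1%N), T p M (e 0%N) (e 1%N) &
    T q M (e 2%N) (e 1%N)]
   ==> [forall j : 'I_n.+1, e 0%N j == e 2%N j]) s) s.
have dnz p k : definable (fun (M : model C) (e : env M) => nz p M (e k)).
  apply: definable_exists => j; apply/definable_not/definable_eq; first exact:
    tdefinable_mev.
  exact: tdefinable_0.
have dT p k l : definable (fun (M : model C) (e : env M) => T p M (e k) (e l)).
  apply: definable_and => //; apply: definable_forall => j; apply: definable_forall => j'.
  by apply: definable_eq; apply: tdefinable_mul;
    do ?[exact: tdefinable_mev|exact: tdefinable_var].
have dinA k : definable (fun (M : model C) (e : env M) => inA M (e k)).
  by apply: definable_and; [apply: definable_normalized_coords|apply:
    (desc_definable dA)].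
have d1 : definable P1 by apply: definable_imply => //; apply: definable_has.
have d2 : definable P2.
  apply: definable_all => p; apply: definable_imply; last exact: (desc_definable dB).
  apply: definable_and; first exact: dinA.
  by apply: definable_and; [apply: definable_normalized_coords|apply: dT].
have d3 : definable P3.
  apply: definable_all => p; apply: definable_all => q; apply: definable_imply.
    do 2![apply: definable_and; first exact: dinA].
    apply: definable_and; first exact: definable_normalized_coords.
    by apply: definable_and; apply: dT.
  by apply: definable_forall => j; apply: definable_eq; apply: tdefinable_var.
have e1 : forall e : env (base_model C), P1 _ e.
  move=> e; apply/implyP => /inA_base[x Ax xE]; have [p ps [j pj]] := Fx x Ax.
  by apply/hasP; exists p => //; apply/existsP; exists j; rewrite (eq_mev _ xE) mev_coord.
have e2 : forall e : env (base_model C), P2 _ e.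
  move=> e; apply/allP => p ps; apply/implyP => /and3P[Ax yn Txy].
  have [x Ax' [_ yE]] := T_base _ _ _ ps Ax yn Txy.
  by rewrite (desc_local dB yE); apply/(desc_base dB)/AB.
have e3 : forall e : env (base_model C), P3 _ e.
  move=> e; apply/allP => p ps; apply/allP => q qs; apply/implyP =>
    /and5P[Ax Ax' yn Txy Txy'].
  have [x Ax1 [xE yE]] := T_base _ _ _ ps Ax yn Txy.
  have [x' Ax1' [xE' yE']] := T_base _ _ _ qs Ax' yn Txy'.
  suff xx' : x = x' by apply/forallP => j; rewrite xE // xE' // xx'.
  apply: finj => //; apply: proj_inj; apply/rowP => j.
  by rewrite -!coordE -yE // yE'.
have := eventually_and (eventually_definable d1 e1)
  (eventually_and (eventually_definable d2 e2) (eventually_definable d3 e3)).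
apply: eventually_mono => i [{}e1 [{}e2 {}e3]].
have /choice[g gP] : forall v : fpoint i n, exists w : fpoint i m, v \in fpoints A i ->
    [/\ normalized_coords m (fcoord w) & exists2 p, p \in s &
      T p (specialization_model i) (fcoord v) (fcoord w)].
  move=> v; have [vA|nv] := boolP (v \in fpoints A i); last first.
    (* An arbitrary value outside of [fpoints A i]. *)
    by exists [ffun=> SeqSub (subfield_seq0 (specialization_fieldP i))].
  have := e1 (fun=> fcoord v); rewrite /P1 /inA; move: (vA); rewrite inE => -> /=
    /hasP[p ps nzp].
  (* The image is computed with any tuple that is nonzero at [v]. Its coordinates, also after
     normalization, lie in the finite subfield; [P3] makes [g] injective whichever tuples are
     used. *)
  pose z j := mev (m := specialization_model i) (F p (inord j)) (fcoord v).
  have zE (j : 'I_m.+1) : z j = mev (m := specialization_model i) (F p j) (fcoord v) by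
    rewrite /z inord_val.
  have zs j : z j \in specialization_field i by apply: mev_in => k; apply: fcoord_in.
  have [|c [a cz] [c0 zn]] := @normalize _ m z.
    by case/existsP: (nzp) => j; rewrite -zE; exists j.
  have ws (j : 'I_m.+1) : z j / c \in specialization_field i.
    by apply: subfield_seqM (specialization_fieldP i) _ _ _ _ => //; apply:
      subfield_seqV (specialization_fieldP i) _ _; rewrite cz.
  pose w : fpoint i m := [ffun j => SeqSub (ws j)].
  have wE (j : 'I_m.+1) : fcoord w j = z j / c by rewrite fcoordE ffunE.
  exists w => _; split.
    case/existsP: zn => b /andP[zb /forallP zlt]; apply/existsP; exists b; rewrite wE zb.
    by apply/forallP => j; rewrite wE; apply: zlt.
  exists p => //; rewrite /T nzp; apply/forallP => j; apply/forallP => k.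
  by rewrite !wE -!zE mulrCA.
have gB v : v \in fpoints A i -> g v \in fpoints B i.
  move=> vA; have [gn [p ps Tp]] := gP v vA; rewrite inE gn /=.
  have /allP/(_ p ps)/implyP := e2 (fun k => if k is 0 then fcoord v else fcoord (g v)).
  by apply; rewrite gn Tp /inA; move: vA; rewrite inE => ->.
rewrite /npoints -(@card_in_imset _ _ g).
  by apply/subset_leq_card/fintype.subsetP => _ /imsetP[v vA ->]; apply: gB.
move=> v v' vA vA' gvv'.
have [gn [p ps Tp]] := gP v vA; have [_ [q qs Tq]] := gP v' vA'.
have /allP/(_ p ps)/allP/(_ q qs)/implyP := e3 (fun k => if k is k'.+1 then
   if k' is 0 then fcoord (g v) else fcoord v' else fcoord v).
rewrite /= gn Tp gvv' Tq /inA; move: vA vA'; rewrite !inE => -> -> /(_ isT) /forallP vE.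
by apply/ffunP => j; apply: val_inj; rewrite -!fcoordE; apply/eqP/vE.
Qed.

Lemma npoints_eq n m (A : set (proj C n)) (B : set (proj C m))
    (f : proj C n -> proj C m) (g : proj C m -> proj C n) :
  (exists Q, describes A Q) -> (exists Q, describes B Q) ->
  regular_on A f -> regular_on B g ->
  (forall x, A x -> B (f x)) -> (forall y, B y -> A (g y)) ->
  (forall x, A x -> g (f x) = x) -> (forall y, B y -> f (g y) = y) ->
  eventually (fun i => npoints A i = npoints B i).
Proof.
move=> dA dB rf rg AB BA gf fg.
have fi x y : A x -> A y -> f x = f y -> x = y by move=> /gf {2}<- /gf {2}<- ->.
have gi x y : B x -> B y -> g x = g y -> x = y by move=> /fg {2}<- /fg {2}<- ->.
apply: eventually_mono (eventually_and (npoints_le dA dB rf AB fi)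
  (npoints_le dB dA rg BA gi)).
by move=> i [le1 le2]; apply/eqP; rewrite eqn_leq le1.
Qed.

End Points.

(** * The stacky point count of a variety with finite groups actions *)

Section Germs.
Variable C : closedFieldType.

Definition eventually_zero : {pred specialization C -> rat} :=
  fun u => `[< eventually (fun i => u i = 0) >].

Lemma eventually_zero_zmod_closed : zmod_closed eventually_zero.
Proof.
split=> [|u v /asboolP u0 /asboolP v0]; apply/asboolP; first exact: eventually_true.
by apply: eventually_mono (eventually_and u0 v0) => i [ui vi]; rewrite !fctE ui vi subrr.
Qed.

HB.instance Definition _ := GRing.isZmodClosed.Build (specialization C -> rat)
  eventually_zero
  eventually_zero_zmod_closed.

(** Germs of rational functions of the specialization along the filter [eventually], the Abelian
    group to which [K0_univ] is applied. *)
Definition germ : zmodType := Quotient.quot eventually_zero.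

Definition germ_of (u : specialization C -> rat) : germ :=
  \pi_(Quotient.quot eventually_zero)%qT u.

Lemma germ_eqP u v : germ_of u = germ_of v <-> eventually (fun i => u i = v i).
Proof.
rewrite /germ_of; split.
  move=> /eqP; rewrite -Quotient.idealrBE => /asboolP; apply: eventually_mono => i /eqP.
  by rewrite !fctE subr_eq0 => /eqP.
move=> uv; apply/eqP; rewrite -Quotient.idealrBE; apply/asboolP.
by apply: eventually_mono uv => i /eqP; rewrite !fctE -subr_eq0 => /eqP.
Qed.

Lemma germ_ofD u v : germ_of (fun i => u i + v i) = germ_of u + germ_of v.
Proof. by rewrite /germ_of -raddfD. Qed.

Definition stacky_count (X : fgvar C) (i : specialization C) : rat :=
  \sum_k (npoints (pts (fg_comp X k)) i)%:R / #|{: fg_group (f := X) k}|%:R.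

Lemma stacky_count_pure (G : finGroupType) (Z : gvar C G) i :
  stacky_count (pure Z) i = (npoints (pts Z) i)%:R / #|{: G}|%:R.
Proof. by rewrite /stacky_count big_ord1. Qed.

Lemma variety_describes (X : variety C) : exists Q, describes (pts X) Q.
Proof. by case: X => n A h; apply: loc_closed_describes. Qed.

Lemma isomorphism_npoints (X Y : variety C) (f : vmap X Y) : is_isomorphism f ->
  eventually (fun i => npoints (pts X) i = npoints (pts Y) i).
Proof.
case=> -[XY rf] [g [[YX rg] gf fg]].
by apply: (npoints_eq _ _ rf rg) => //; apply: variety_describes.
Qed.

(** Each point lies in exactly one piece of a partition, and matched pieces have equal point counts
    and groups of the same order. *)
Lemma stacky_count_equiv (X Y : fgvar C) : fg_equiv X Y ->
  eventually (fun i => stacky_count X i = stacky_count Y i).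
Proof.
have part (Z : fgvar C) (P : partition Z) : eventually (fun i => stacky_count Z i =
    \sum_(k : {k : 'I_(fg_num Z) & 'I_(np P k)})
      (npoints (piece (tagged k)) i)%:R / #|{: fg_group (f := Z) (tag k)}|%:R).
  have wt k : eventually (fun i => \sum_j npoints (@piece _ _ P k j) i =
    1 * npoints (pts (fg_comp Z k)) i)%N.
    apply: npoints_weight => [|j|j|x Zx].
    - exact: variety_describes.
    - by apply: loc_closed_describes; case: (pieceP P k j).
    - by case: (pieceP P k j).
    have [j [jx juniq]] := piece_cover P Zx.
    apply: (eq_card1 (x := j)) => j'; rewrite !inE; apply/asboolP/eqP =>
      [/juniq->//|->//].
  apply: eventually_mono (eventually_forall wt) => i iP.
  rewrite /stacky_count (eq_bigr
    (fun k => \sum_j (npoints (@piece _ _ P k j) i)%:R / #|{: fg_group (f := Z) k}|%:R)).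
    by rewrite sig_big_dep.
  by move=> k _; rewrite -mulr_suml -natr_sum iP mul1n.
case=> P [Q [s [sbij iso]]].
have eqN k : eventually (fun i =>
  (npoints (piece (tagged k)) i)%:R / #|{: fg_group (f := X) (tag k)}|%:R =
    (npoints (piece (tagged (s k))) i)%:R / #|{: fg_group (f := Y) (tag (s k))}|%:R :>
      rat).
  have [phi [psi [phib _ psii _]]] := iso k.
  apply: eventually_mono (isomorphism_npoints psii) => i /= ->.
  by rewrite (bij_eq_card phib).
apply: eventually_mono (eventually_and (part X P) (eventually_and (part Y Q)
  (eventually_forall (J := {k : 'I_(fg_num X) & 'I_(np P k)}) eqN))) => i [-> [-> E]].
by rewrite [RHS](reindex s) /=; [apply: eq_bigr => k _; apply: E|apply: onW_bij].
Qed.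

Lemma stacky_count_closed (X : fgvar C) (A : forall i, set (proj C (vdim (fg_comp X i))))
    (hA : forall i, inv_subvar (X := fg_comp X i) (A i))
    (hB : forall i, inv_subvar (X := fg_comp X i) (pts (fg_comp X i) `\` A i)) :
  eventually (fun i => stacky_count X i =
    stacky_count (fg_restrict hA) i + stacky_count (fg_restrict hB) i).
Proof.
have wt k : eventually (fun i =>
  \sum_b npoints (if b then A k else pts (fg_comp X k) `\` A k) i
    = 1 * npoints (pts (fg_comp X k)) i)%N.
  have [lA AX _] := hA k; have [lB _ _] := hB k.
  apply: npoints_weight => [|[]|[]|x Xx].
  - exact: variety_describes.
  - exact: loc_closed_describes.
  - exact: loc_closed_describes.
  - by [].
  - by move=> x [].
  have [Ax|nAx] := pselect (A k x).
    apply: (eq_card1 (x := true)) => -[]; rewrite !inE; apply/asboolP => //.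
    by case.
  by apply: (eq_card1 (x := false)) => -[]; rewrite !inE; apply/asboolP.
apply: eventually_mono (eventually_forall wt) => i iP.
rewrite /stacky_count -big_split /=; apply: eq_bigr => k _.
by rewrite -mulrDl -natrD -[npoints (pts (fg_comp X k)) i]mul1n -iP big_bool.
Qed.

(** The images of the [pi h], one for each element of [H], have as many points as [Z] and cover each
    point of [W] exactly #|G| times; double counting relates the two quotients. *)
Lemma stacky_count_ind (G H : finGroupType) (j : G -> H) (Z : gvar C G) (W : gvar C H) :
  injective j -> {morph j : g h / (g * h)%g} -> is_induced j Z W ->
  eventually (fun i => stacky_count (pure W) i = stacky_count (pure Z) i).
Proof.
move=> jinj jM [pi [pi_open pi_surj pi_eq _]].
have dZ := variety_describes Z; have dW := variety_describes W.
have im_describes h : exists Q, describes (pi h @` pts Z) Q.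
  have [_ [D cD ->] _] := pi_open h.
  by apply: describesD => //; apply: zariski_closed_describes.
have eqN h : eventually (fun i => npoints (pi h @` pts Z) i = npoints (pts Z) i).
  have [[ZW rpi] _ [g rg gK]] := pi_open h.
  apply: (npoints_eq (f := g) (g := pi h)) => //.
  - by move=> _ [x Zx <-]; rewrite gK.
  - by move=> _ [x Zx <-]; rewrite gK.
have wt : eventually (fun i => \sum_h npoints (pi h @` pts Z) i =
  #|{: G}| * npoints (pts W) i)%N.
  apply: npoints_weight => // [h w [x Zx <-]|w Ww].
    by have [[ZW _] _ _] := pi_open h; apply: ZW.
  have [h0 [x0 Zx0 wE]] := pi_surj w Ww.
  have [mor _ _] := actP Z; have actZ g x : Z x -> Z (act g x) by have [ZZ _] := mor g;
    apply: ZZ.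
  (* The elements [h] for which [w] is in the image of [pi h] form the left coset of [h0] modulo the
     image of [j]. *)
  have finj : injective (fun g => h0 * j g)%g by move=> g g' /mulgI/jinj.
  rewrite -(card_imset _ finj); apply: eq_card => h; rewrite !inE.
  have j1 : j 1%g = 1%g by apply: (mulgI (j 1%g)); rewrite -jM !mulg1.
  apply/asboolP/imsetP => [[x Zx pix]|[g _ ->]].
    have [g [hE _]] : exists g, h = (h0 * (j g)^-1)%g /\ x = act g x0.
      by apply/(pi_eq _ _ _ _ Zx0 Zx); rewrite -wE.
    exists g^-1%g => //; rewrite hE; congr (_ * _)%g; apply: (mulgI (j g)).
    by rewrite mulgV -jM mulgV j1.
  exists (act g^-1%g x0); first exact: actZ.
  rewrite wE; symmetry; apply/(pi_eq _ _ _ _ Zx0 (actZ _ _ Zx0)).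
  by exists (g^-1)%g; split=> //; congr (_ * _)%g; apply: (mulgI (j g^-1%g));
    rewrite mulgV -jM mulVg j1.
apply: eventually_mono (eventually_and wt (eventually_forall eqN)) => i [E1 E2].
rewrite !stacky_count_pure.
have card0 (K : finGroupType) : #|{: K}|%:R != 0 :> rat.
  by rewrite pnatr_eq0 -lt0n; apply/card_gt0P; exists 1%g.
apply/eqP; rewrite eqr_div //; apply/eqP; rewrite -!natrM; congr _%:R.
rewrite mulnC -E1 (eq_bigr (fun _ => npoints (pts Z) i)) // sum_nat_const mulnC.
by [].
Qed.

Lemma germ_relations : fg_relations (fun X => germ_of (stacky_count X)).
Proof.
split=> [X Y XY|X A hA hB _|G H j Z W jinj jM ind].
- exact/germ_eqP/stacky_count_equiv.
- by rewrite -germ_ofD; apply/germ_eqP/stacky_count_closed.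
- by apply/germ_eqP/(stacky_count_ind jinj jM ind).
Qed.

End Germs.

(** * Power structures and the classes of points *)

Section Series.
Variable R : comPzRingType.

Lemma series_mulr1 (A : series R) : series_mul A (series_one R) =1 A.
Proof.
move=> n; rewrite /series_mul big_ord_recr /= subnn /series_one mulr1 big1 ?add0r // =>
  i _.
by rewrite subn_eq0 leqNgt ltn_ord mulr0.
Qed.

(** Multiplying a series with constant term 1 by a factor 1 + c t^n + ... leaves the coefficients
    below [n] unchanged and adds [c] to the [n]-th one. *)
Lemma big_series_rcons (f : nat -> series R) (s : seq nat) n c :
  (forall i, f i 0%N = 1) -> (forall k, (0 < k < n)%N -> f n k = 0) -> (0 < n)%N ->
    f n n = c ->
  let S := \big[@series_mul R/series_one R]_(i <- s) f i in
  let S' := \big[@series_mul R/series_one R]_(i <- rcons s n) f i in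
  [/\ S 0%N = 1, forall k, (k < n)%N -> S' k = S k & S' n = S n + c].
Proof.
move=> f0 fn n0 fc; elim: s => [|a s [IH0 IHk IHn]] /=.
  rewrite big_nil big_cons big_nil; split=> // [[|k] lt_k|]; rewrite series_mulr1.
  - by rewrite f0.
  - by rewrite fn.
  - by rewrite fc /series_one (gtn_eqF n0) add0r.
rewrite !big_cons; split=> [|k lt_k|].
- by rewrite /series_mul big_ord1 subn0 f0 IH0 mulr1.
- by apply: eq_bigr => i _; rewrite IHk // (leq_ltn_trans _ lt_k) // leq_subr.
rewrite /series_mul !big_ord_recl subn0 IHn f0 !mul1r [RHS]addrAC; congr (_ + _).
apply: eq_bigr => i _; rewrite IHk //; rewrite /= /bump /=; lia.
Qed.

Section Lambda.
Variable lam : R -> series R.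
Hypothesis lam0 : forall a, lam a 0%N = 1.
Hypothesis lam1 : forall a, lam a 1%N = a.

Definition truncated_prod (b : nat -> R) (n : nat) : series R :=
  \big[@series_mul R/series_one R]_(1 <= i < n) series_subst (lam (b i)) i.

Lemma lambda_prodS b n :
  lambda_prod lam b n.+1 = truncated_prod b n.+1 n.+1 + b n.+1.
Proof.
rewrite /lambda_prod /truncated_prod.
have -> : index_iota 1 n.+2 = rcons (index_iota 1 n.+1) n.+1.
  by rewrite /index_iota !subSS !subn0 -[n.+1]addn1 iotaD cats1 add1n addn1.
have [] // := @big_series_rcons (fun i => series_subst (lam (b i)) i)
  (index_iota 1 n.+1) n.+1 (b n.+1).
- by move=> i; rewrite /series_subst dvdn0 div0n.
- move=> k /andP[k0 lt_k]; rewrite /series_subst; case: ifP => // /dvdn_leq.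
  by move=> /(_ k0); rewrite leqNgt lt_k.
- by rewrite /series_subst dvdnn divnn /= lam1.
Qed.

Lemma eq_truncated_prod b b' n : (forall i, (i < n)%N -> b i = b' i) ->
  truncated_prod b n = truncated_prod b' n.
Proof. by move=> bb'; apply: eq_big_nat => i /andP[_ lt_i]; rewrite bb'. Qed.

Lemma lambda_prod_exists (A : series R) : A 0%N = 1 -> exists b, A =1 lambda_prod lam b.
Proof.
move=> A0.
(* [bs n] lists [b 0], ..., [b n]. By [lambda_prodS], each new exponent is what the product of the
   preceding factors misses in the coefficient; the irrelevant [b 0] is set to 0. *)
pose fix bs n : seq R := if n is n'.+1 then
  rcons (bs n') (A n'.+1 - truncated_prod (nth 0 (bs n')) n'.+1 n'.+1) else [:: 0].
have sz n : size (bs n) = n.+1 by elim: n => //= n IH; rewrite size_rcons IH.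
have nthE n i : (i <= n)%N -> nth 0 (bs n) i = nth 0 (bs i) i.
  elim: n => [|n IH]; first by rewrite leqn0 => /eqP->.
  rewrite leq_eqVlt => /predU1P[->//|]; rewrite ltnS => le_i.
  by rewrite /= nth_rcons sz ltnS le_i IH.
exists (fun i => nth 0 (bs i) i) => -[|n].
  by rewrite A0 /lambda_prod big_geq.
have E : truncated_prod (fun i => nth 0 (bs i) i) n.+1 =
  truncated_prod (nth 0 (bs n)) n.+1.
  by apply: eq_truncated_prod => i; rewrite ltnS => /nthE.
by rewrite lambda_prodS /= nth_rcons sz ltnn eqxx E addrC subrK.
Qed.

Lemma lambda_prod1 b : lambda_prod lam b 1 = b 1%N.
Proof. by rewrite lambda_prodS /truncated_prod big_geq // /series_one add0r. Qed.

Lemma lambda_prod2 b : lambda_prod lam b 2 = lam (b 1%N) 2 + b 2%N.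
Proof.
by rewrite lambda_prodS /truncated_prod big_ltn // big_geq // series_mulr1 /series_subst
  dvd1n divn1.
Qed.

(** The base is 1 + t. Comparing its coefficients of t and t^2 with [lambda_prod1] and
    [lambda_prod2] gives [b 1 = 1] and [b 2 = - lam 1 2], and these are then multiplied by [m]. *)
Lemma power_linear m : exists2 B : series R,
  is_power lam (fun n => (n <= 1)%N%:R) m B & B 2 = lam m 2 - m * lam 1 2.
Proof.
have [b Ab] := @lambda_prod_exists (fun n => (n <= 1)%N%:R) erefl.
have b1 : b 1%N = 1 by rewrite -lambda_prod1 -Ab.
have b2 : b 2 = - lam 1 2.
  by apply/eqP; rewrite -addr_eq0 addrC -{1}b1 -lambda_prod2 -Ab.
exists (lambda_prod lam (fun i => m * b i)); first by exists b.
by rewrite lambda_prod2 b1 mulr1 b2 mulrN.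
Qed.

End Lambda.
End Series.

(** * Classes of one-point varieties *)

Section PointClasses.
Variable C : closedFieldType.

Lemma proj0_coord (x : proj C 0) i : coords x 0 i = 1.
Proof. by case: x => v vn /=; case/existsP: (vn) => j /andP[/eqP <- _];
  rewrite !ord1. Qed.

Lemma proj0_subsingleton (x y : proj C 0) : x = y.
Proof. by apply: proj_inj; apply/rowP => i; rewrite !proj0_coord. Qed.

Lemma proj0_normalized : normalized (const_mx 1 : 'rV[C]_1).
Proof.
by apply/existsP; exists 0; rewrite mxE eqxx; apply/forallP => j; rewrite ord1.
Qed.

Lemma loc_closed_setT n : loc_closed [set: proj C n].
Proof.
exists setT, set0; split; last by rewrite setD0.
- exists set0 => //; apply/seteqP; split=> // x _ p [].
- exists [set 1] => [p ->|]; first by exists 0%N; apply: dhomog1.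
  by apply/seteqP; split=> // x /(_ 1 erefl)/eqP; rewrite /peval meval1 oner_eq0.
Qed.

Definition point : variety C := Variety (loc_closed_setT 0).

Lemma is_morphism_point (X : variety C) (f : vmap X point) : is_morphism f.
Proof.
split=> // x _; exists 0%N, (fun=> 1); split.
- by move=> i; apply: dhomog1.
- by exists 0; rewrite /peval meval1 oner_eq0.
- by move=> y _; exists 1 => i; rewrite /peval meval1 proj0_coord mulr1.
Qed.

Lemma point_action (G : finGroupType) : is_action (X := point) (fun (g : G) x => x).
Proof. by split=> // g; apply: is_morphism_point. Qed.

Definition gpoint (G : finGroupType) : gvar C G := GVar (point_action G).

Lemma point_is_product (I : Type) (pr : forall i : I, vmap point point) :
  is_product (X := fun=> point) pr.
Proof.
split=> [i|W f _]; first exact: is_morphism_point.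
exists (fun=> Proj proj0_normalized); split=> [|i w _|u _ _ w _].
- exact: is_morphism_point.
- exact: proj0_subsingleton.
- exact: proj0_subsingleton.
Qed.

Lemma gpoint_wreath_power (G : finGroupType) n :
  is_wreath_power (gpoint G) (gpoint (wreath n G)).
Proof. by exists (fun _ x => x); split; first exact: point_is_product. Qed.

Lemma gpoint_gproduct (G1 G2 : finGroupType) :
  is_gproduct (gpoint G1) (gpoint G2) (gpoint (G1 * G2)%type).
Proof.
exists id, id; split=> //; split=> [[]|W f _]; try exact: is_morphism_point.
exists (fun=> Proj proj0_normalized); split=> [|[] w _|u _ _ w _].
- exact: is_morphism_point.
- exact: proj0_subsingleton.
- exact: proj0_subsingleton.
- exact: proj0_subsingleton.
Qed.

(** The description of the point picked by [desc] is not explicit, so the fact that it admits all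
    normalized vectors is transferred from [C]. Positivity makes the final inequality strict. *)
Lemma npoints_point : eventually (fun i => 0 < npoints (pts point) i)%N.
Proof.
have dT := descP (variety_describes point).
have dP : definable (fun (m : model C) (e : env m) =>
    normalized_coords 0 (e 0%N) ==> @desc C 0 (pts point) m (e 0%N)).
  by apply: definable_imply; [apply: definable_normalized_coords|apply:
    (desc_definable dT)].
have eP (e : env (base_model C)) : normalized_coords 0 (e 0%N) ==>
  @desc C 0 (pts point) _ (e 0%N).
  by apply/implyP => /normalized_coords_proj[y /(desc_local dT) ->]; apply/(desc_base dT).
apply: eventually_mono (eventually_definable dP eP) => i iP.
apply/card_gt0P; exists [ffun=> SeqSub (subfield_seq1 (specialization_fieldP i))].
set v := finfun _; have vn : normalized_coords 0 (fcoord v).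
  by apply/existsP; exists 0; rewrite fcoordE ffunE eqxx; apply/forallP => j;
    rewrite ord1.
by rewrite inE vn; apply: implyP (iP (fun=> fcoord v)) vn.
Qed.

(** The union of no components splits into two copies of itself, so its class is twice itself. This
    makes the zero coefficients of 1 + t effective. *)
Lemma class_zero_effective (K : comPzRingType) (cl : fgvar C -> K) :
  fg_relations cl -> effective_class cl 0.
Proof.
move=> rel; pose X := @FGVar C 0 (fun=> {perm 'I_1} : finGroupType) (fun=> gpoint _).
exists X.
have hA i : inv_subvar (X := fg_comp X i) set0 by case: i.
have hB i : inv_subvar (X := fg_comp X i) (pts (fg_comp X i) `\` set0) by case: i.
have clA i : closed_in (X := fg_comp X i) set0 by case: i.
have XA : fg_restrict hA = X by rewrite /fg_restrict /X /=; congr FGVar; apply: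
  functional_extensionality_dep => -[].
have XB : fg_restrict hB = X by rewrite /fg_restrict /X /=; congr FGVar; apply:
  functional_extensionality_dep => -[].
have := fgrel_closed rel hA hB clA; rewrite XA XB => e.
by apply: (addrI (cl X)); rewrite addr0 -e.
Qed.

End PointClasses.

(** * A noneffective power of 1 + t *)

Theorem not_effective (C : closedFieldType) (K : comPzRingType) (cl : fgvar C -> K)
  (hC : [pchar C] =i pred0) (hK : is_K0fGr cl) (lam : K -> series K)
    (hlam : kapranov_lambda cl lam) :
  ~ effective_power lam (effective_class cl).
Proof.
case: hK => rel univ mulK oneK; case: hlam => [[lam0 lam1 _] lamW] eff.
(* Symmetric groups provide groups of orders 1 and 2. *)
pose T : finGroupType := {perm 'I_1}; pose G : finGroupType := {perm 'I_2}.
have card_T : #|{: T}| = 1%N by rewrite card_Sn.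
have card_G : #|{: G}| = 2%N by rewrite card_Sn.
have card_wreath (H : finGroupType) : #|{: wreath 2 H}| = (#|{: H}| ^ 2 * 2)%N.
  by rewrite card_prod card_ffun card_ord card_Sn.
have cl1 : cl (pure (gpoint C T)) = 1.
  apply: oneK => //; exists (Proj (proj0_normalized C)).
  by apply/seteqP; split=> // x _; apply: proj0_subsingleton.
have lamE (H : finGroupType) : lam (cl (pure (gpoint C H))) 2 =
  cl (pure (gpoint C (wreath 2 H))).
  by apply: lamW => //; apply: gpoint_wreath_power.
have eff0 := class_zero_effective rel.
have [B powB B2] := power_linear lam0 lam1 (cl (pure (gpoint C G))).
have [|n||X XE] := eff _ _ B _ _ _ powB 2.
- by [].
- case: leqP => _; last by [].
  by exists (pure (gpoint C T)); rewrite cl1.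
- by exists (pure (gpoint C G)).
have [h hE _] := univ _ _ (germ_relations C).
(* If the coefficient of t^2 were the class of some [X], then the class of the point with
   [wreath 2 G], of order 8, would be that of [X] plus that of the point with the product of [G] and
   [wreath 2 T], of order 4. *)
move: XE; rewrite B2 -cl1 !lamE (mulK _ _ _ _ _ (gpoint_gproduct C G (wreath 2 T))).
move=> /eqP; rewrite subr_eq => /eqP/(congr1 h); rewrite raddfD /= !hE -germ_ofD.
move=> /germ_eqP ev; have [i [E N0]] :=
  eventually_exists hC (eventually_and ev (npoints_point C)).
move: E; rewrite !stacky_count_pure card_wreath card_prod card_wreath card_T card_G /=.
(* At a common specialization, N/8 equals the count of [X] plus N/4, which is absurd since N is
   positive and the count of [X] is nonnegative. *)
set N := (npoints _ i)%:R : rat; have {}N0 : 0 < N by rewrite ltr0n.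
have : 0 <= stacky_count X i.
  by apply: sumr_ge0 => k _; rewrite divr_ge0 // ler0n.
lra.
Qed.

Theorem mainTheorem5 (R : realType) (K : comPzRingType) (cl : fgvar R[i]%C -> K)
  (hK : is_K0fGr cl) (lam : K -> series K) (hlam : kapranov_lambda cl lam) :
  ~ effective_power lam (effective_class cl).
Proof. by apply: not_effective hK _ hlam; apply: pchar_num. Qed.
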